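(* Let $(\rho_{\theta})_{\theta \in U}$ and $(\pi_{\theta})_{\theta \in U}$ be non-degenerate families of projections onto lines and planes in $\mathbb{R}^3$, respectively. Let $B \subset \mathbb{R}^{3}$ be an analytic set. (a) If $\dim_{\mathrm{H}} B \leq 1/2$, then $\dim_{\mathrm{H}} \rho_{\theta}(B) = \dim_{\mathrm{H}} B$ for Lebesgue almost every $\theta\in U$. (b) If $\dim_{\mathrm{H}} B \leq 1$, then $\dim_{\mathrm{H}} \pi_{\theta}(B) = \dim_{\mathrm{H}} B$ for Lebesgue almost every $\theta\in U$.
   Context: $\dim_{\mathrm{H}}$ denotes Hausdorff dimension. Non-degenerate families: let $U \subset \mathbb{R}$ be an open interval and $\gamma \colon U \to S^2$ a $\mathcal{C}^{3}$-curve on the unit sphere in $\mathbb{R}^3$ with $\operatorname{span}(\{\gamma(\theta),\dot{\gamma}(\theta),\ddot{\gamma}(\theta)\}) = \mathbb{R}^{3}$ for all $\theta \in U$. Put $\ell_\theta = \operatorname{span}(\gamma(\theta))$ and $V_\theta = \ell_\theta^\perp$. The associated non-degenerate family of projections onto lines is $\rho_\theta \colon \mathbb{R}^3 \to \mathbb{R}$, $\rho_\theta(x) = \gamma(\theta)\cdot x$, $\theta \in U$; the associated non-degenerate family of projections onto planes is $(\pi_\theta)_{\theta\in U}$, where $\pi_\theta$ is the orthogonal projection onto the plane $V_\theta$, identified with $\mathbb{R}^2$. *)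

(* Defs.v *)
From HB Require Import structures.
From mathcomp Require Import all_boot all_order all_algebra.
From mathcomp Require Import all_classical all_reals all_analysis.
Set Implicit Arguments.
Unset Strict Implicit.
Unset Printing Implicit Defensive.
Import Order.TTheory GRing.Theory Num.Theory.
Import numFieldNormedType.Exports.
Local Open Scope ring_scope.
Local Open Scope classical_set_scope.

Section EuclideanSpace.
Context {R : realType} {n : nat}.
Implicit Types u v : 'rV[R]_n.

Definition dot u v : R := \sum_(i < n) u 0 i * v 0 i.
Definition enorm u : R := Num.sqrt (dot u u).

(* The library norm on 'rV[R]_n is the sup norm, hence an explicit distance. *)
Definition edist u v : R := enorm (u - v).

End EuclideanSpace.

(* The ambient metric is the parameter d, so that the same definitions apply
   to subsets of R and of R^n. *)
Section HausdorffDimension.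
Context {R : realType} {T : Type} (d : T -> T -> R).
Local Open Scope ereal_scope.
Implicit Types (A : set T) (s : R).

(* The point 0 is added so that the empty set has diameter 0, not -oo. *)
Definition diameter A : \bar R :=
  ereal_sup (0 |` [set (d p.1 p.2)%:E | p in A `*` A]).

(* diam(A)^s, with the usual conventions for s = 0: the empty set contributes 0
   and a singleton contributes 0^0 = 1. *)
Definition diameter_pow s A : \bar R :=
  if A == set0 then 0 else poweR (diameter A) s.

Definition hausdorff_content s (delta : R) A : \bar R :=
  ereal_inf [set \sum_(0 <= i <oo) diameter_pow s (E i)
            | E in [set E : (set T)^nat | A `<=` \bigcup_i E i /\
                                         forall i, diameter (E i) <= delta%:E]].

(* The content increases as delta decreases to 0, so the limit is the sup. *)
Definition hausdorff_measure s A : \bar R :=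
  ereal_sup [set hausdorff_content s delta A
            | delta in [set delta : R | (0 < delta)%R]].

Definition hausdorff_dim A : \bar R :=
  ereal_inf [set s%:E | s in [set s : R | (0 <= s)%R /\
                                         hausdorff_measure s A = 0]].

End HausdorffDimension.

(* dim_H for subsets of the line and of Euclidean space. *)
Definition dimH_line {R : realType} (A : set R) : \bar R :=
  hausdorff_dim (fun x y => `|x - y|) A.
Definition dimH {R : realType} {n : nat} (A : set 'rV[R]_n) : \bar R :=
  hausdorff_dim edist A.

Definition baire_space := prod_topology (fun _ : nat => nat).

Definition analytic {T : topologicalType} (A : set T) : Prop :=
  A = set0 \/ exists2 f : baire_space -> T, continuous f & A = range f.

Definition open_interval {R : realType} (U : set R) : Prop :=
  open U /\ is_interval U.

(* gamma is total; only its values on the open set U matter. *)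
Definition C3_on {R : realType} {V : normedModType R} (U : set R)
    (gamma : R -> V) : Prop :=
  (forall k, (k < 3)%N -> forall t, U t -> derivable (gamma^`(k)) t 1) /\
  (forall t, U t -> {for t, continuous (gamma^`(3))}).

Definition nondegenerate_curve {R : realType} (U : set R)
    (gamma : R -> 'rV[R]_3) : Prop :=
  [/\ C3_on U gamma,
      forall t, U t -> enorm (gamma t) = 1 &
      forall t, U t ->
        (<<[:: gamma t; gamma^`() t; gamma^`(2) t]>> = fullv)%VS].

Section Projections.
Context {R : realType} {n : nat} (gamma : R -> 'rV[R]_n).
Implicit Types (t : R) (x : 'rV[R]_n).

Definition ell t : {vspace 'rV[R]_n} := <[gamma t]>%VS.
Definition Vperp t : set 'rV[R]_n :=
  [set y | forall z, z \in ell t -> dot z y = 0].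

Definition rho t x : R := dot (gamma t) x.

(* The plane Vperp t is kept as a subset of R^n with the induced Euclidean
   metric instead of being identified isometrically with R^(n-1). The formula
   is the orthogonal projection because gamma t is a unit vector; see
   proj_planeP. *)
Definition proj_plane t x : 'rV[R]_n := x - dot (gamma t) x *: gamma t.

Lemma proj_planeP t x y : enorm (gamma t) = 1 ->
  y = proj_plane t x <-> Vperp t y /\ forall z, Vperp t z -> dot (x - y) z = 0.
Proof.
have dotC (u v : 'rV[R]_n) : dot u v = dot v u.
  by apply: eq_bigr => i _; rewrite mulrC.
have dotD (u v w : 'rV[R]_n) : dot u (v + w) = dot u v + dot u w.
  by rewrite -big_split; apply: eq_bigr => i _; rewrite mxE mulrDr.
have dotZ (u v : 'rV[R]_n) a : dot u (a *: v) = a * dot u v.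
  by rewrite big_distrr; apply: eq_bigr => i _; rewrite mxE mulrCA.
have dotB (u v w : 'rV[R]_n) : dot u (v - w) = dot u v - dot u w.
  by rewrite dotD -scaleN1r dotZ mulN1r.
have dot_ge0 (u : 'rV[R]_n) : 0 <= dot u u.
  by apply: sumr_ge0 => i _; rewrite -expr2 sqr_ge0.
have dot_eq0 (u : 'rV[R]_n) : dot u u = 0 -> u = 0.
  move/eqP; rewrite psumr_eq0; last by move=> i _; rewrite -expr2 sqr_ge0.
  move/allP => u0; apply/rowP => i; rewrite mxE; apply/eqP.
  by have := u0 i (mem_index_enum i); rewrite /= -expr2 sqrf_eq0.
move=> g1; have gg : dot (gamma t) (gamma t) = 1.
  by rewrite -[LHS]sqr_sqrtr// -/(enorm _) g1 expr1n.
have perpP z : Vperp t z <-> dot (gamma t) z = 0.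
  split=> [|gz w /vlineP[a ->]]; first by apply; exact: memv_line.
  by rewrite dotC dotZ dotC gz mulr0.
have perp_proj : Vperp t (proj_plane t x).
  by apply/perpP; rewrite dotB dotZ gg mulr1 subrr.
have proj_perp z : Vperp t z -> dot (x - proj_plane t x) z = 0.
  by move=> /perpP gz; rewrite /proj_plane subKr dotC dotZ [dot z _]dotC gz mulr0.
split=> [->//|[Vy xy]]; apply/eqP; rewrite -subr_eq0; apply/eqP/dot_eq0.
have Vd : Vperp t (y - proj_plane t x).
  apply/perpP; rewrite dotB.
  by move/perpP: Vy => ->; move/perpP: perp_proj => ->; rewrite subrr.
have dE : y - proj_plane t x = (x - proj_plane t x) - (x - y).
  by move: (proj_plane t x) => p; rewrite opprB [RHS]addrC addrA subrK.
by rewrite {2}dE dotB dotC proj_perp// dotC xy// subrr.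
Qed.

End Projections.

(* Main.v *)
Require Import Defs.
From HB Require Import structures.
From mathcomp Require Import all_boot all_order all_algebra.
From mathcomp Require Import zify ring lra.
From mathcomp Require Import all_classical all_reals all_analysis.
From mathcomp Require Import measurable_realfun.
Set Implicit Arguments.
Unset Strict Implicit.
Unset Printing Implicit Defensive.
Import Order.TTheory GRing.Theory Num.Theory.
Import numFieldNormedType.Exports.
Local Open Scope ring_scope.
Local Open Scope classical_set_scope.

(* For s < dim B <= a, with a = 1/2 (lines) or a = 1 (planes), B has positive
   L^2-capacity: the least energy of a function on dyadic cubes whose sums
   sum_j 2^(js/2) u(Q_j(x)) are at least 1 at every x in B, with Q_j(x) the cube
   of side 2^-j containing x. The parallelogram law makes this capacity
   continuous along increasing unions, so for B = f(Baire space) it stays above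
   some c > 0 on the images of the boxes {x | x_i <= k_i for i < n}, for a
   suitable k and all n. Minimizing a quadratic form over a simplex gives, for
   each n, a finitely supported probability measure mu_n on that image with
   s-energy at scales >= 2^-n bounded independently of n.

   Nondegeneracy of the curve bounds the measure of {t | |pi_t u| <= r} by
   C (r/|u|)^a, hence the integral over t of the truncated s-energy of the
   projection of mu_n, and by Fatou's lemma these energies are bounded along a
   subsequence for almost every t. For such t, an open cover of pi_t(B) pulls
   back to an open cover of the compact f({x | x_i <= k_i for all i}), and
   finitely many of its sets cover the support of mu_n for large n;
   Cauchy-Schwarz then bounds the sum of the s-th powers of the diameters from
   below. No limit of the measures mu_n is needed. *)

(** * Capacity of a kernel *)

(** A Frostman measure on an analytic set needs a set function that passes to increasing unions.
    Hausdorff contents do this only with effort; an energy is a squared Hilbert norm, whose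
    near-minimizers are Cauchy, so the [L^2]-capacity does it directly. The price is a loss of
    exponent: a null capacity at exponent [s] gives null Hausdorff measure only at exponents
    [s' > s]. This is harmless, because only exponents below [dim B] are used and they may tend to
    [dim B]. A second strict gap, [s < a], makes the powers of [2^-a / 2^-s] summable when energies
    are integrated in [t]; since [s < dim B], the case [dim B = a] is included.

    The value of [a] reflects orders of vanishing. Along the curve, [gamma t . u] may vanish
    together with its first derivative, but then the second one is of size [|u|], and the set where
    [|gamma t . u| <= r] has measure of order [(r / |u|)^(1/2)]. The projection of [u] to the plane
    vanishes to first order only, which gives the power 1. *)

Section Capacity.
Context {R : realType} {X : Type} {T : choiceType}.
Implicit Types (K : X -> T -> R) (u v : T -> R) (A : set X).
Local Open Scope ereal_scope.

Definition energy u : \bar R := \esum_(p in setT) (u p ^+ 2)%:E.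

Definition admissible K A u : Prop :=
  (forall p, 0 <= u p)%R /\
  forall x, A x -> 1 <= \esum_(p in setT) (K x p * u p)%:E.

(** Meyers's [L^2]-capacity for the kernel [K], with counting measure on [T]. *)
Definition capacity K A : \bar R :=
  ereal_inf [set energy u | u in [set u | admissible K A u]].

Lemma energy_ge0 u : 0 <= energy u.
Proof. by apply: esum_ge0 => p _; rewrite lee_fin sqr_ge0. Qed.

Lemma capacity_ge0 K A : 0 <= capacity K A.
Proof. by apply/ereal_infP => _ [u _ <-]; exact: energy_ge0. Qed.

Lemma capacity_le K A u : admissible K A u -> capacity K A <= energy u.
Proof. by move=> Au; apply: ereal_inf_lbound; exists u. Qed.

Lemma admissible_subset K A A' u :
  A `<=` A' -> admissible K A' u -> admissible K A u.
Proof. by move=> AA' [u0 uA']; split=> // x /AA'; exact: uA'. Qed.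

Lemma capacity_subset K A A' : A `<=` A' -> capacity K A <= capacity K A'.
Proof.
move=> AA'; apply/ereal_infP => _ [u /(admissible_subset AA') uA <-].
exact: capacity_le.
Qed.

Lemma esumZ_le (c : R) (a : T -> \bar R) : (0 <= c)%R ->
  (forall p, 0 <= a p) ->
  \esum_(p in setT) (c%:E * a p) <= c%:E * \esum_(p in setT) a p.
Proof.
move=> c0 a0; apply: ge_ereal_sup => _ [F [finF _] <-].
rewrite -ge0_mule_fsumr//; apply: lee_pmul => //.
  by rewrite fsume_ge0.
by apply: ereal_sup_ubound; exists F => //; split.
Qed.

Lemma admissible_midpoint K A u v : (forall x p, 0 <= K x p)%R ->
  admissible K A u -> admissible K A v ->
  admissible K A (fun p => (u p + v p) / 2)%R.
Proof.
move=> K0 [u0 uA] [v0 vA]; split=> [p|x Ax].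
  by rewrite divr_ge0// addr_ge0.
have h : (2^-1)%:E + (2^-1)%:E = 1%:E :> \bar R.
  by rewrite -EFinD; congr EFin; lra.
rewrite -h.
under eq_esum do rewrite mulrA mulrDr mulrDl EFinD.
rewrite esumD; last 2 first.
- by move=> p _; rewrite lee_fin !mulr_ge0// invr_ge0.
- by move=> p _; rewrite lee_fin !mulr_ge0// invr_ge0.
have half w : (forall p, 0 <= w p)%R -> 1 <= \esum_(p in setT) (K x p * w p)%:E ->
    (2^-1)%:E <= \esum_(p in setT) (K x p * w p / 2)%:E.
  move=> w0 w1; have : \esum_(p in setT) (K x p * w p)%:E <=
      2%:E * \esum_(p in setT) (K x p * w p / 2)%:E.
    apply: le_trans (esumZ_le _ _) => //.
      apply: le_esum => p _; rewrite -EFinM lee_fin mulrCA mulrC.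
      by rewrite mulfV ?mulr1.
    by move=> p; rewrite lee_fin !mulr_ge0// invr_ge0.
  move=> /(le_trans w1) /(@lee_wpmul2l _ (2^-1)%:E).
  rewrite muleA -!EFinM mulr1 mulVf// mul1e; apply.
  by rewrite lee_fin invr_ge0.
by apply: leeD; apply: half; auto.
Qed.

(* The parallelogram law makes near-minimizers of the energy close. *)
Lemma near_minimizers_close K A (u v : T -> R) (a d : R) :
  (forall x p, 0 <= K x p)%R -> admissible K A u -> admissible K A v ->
  (a - d)%:E <= capacity K A -> energy u <= (a + d)%:E ->
  energy v <= (a + d)%:E ->
  energy (fun p => (u p - v p) / 2)%R <= (2 * d)%:E.
Proof.
move=> K0 Au Av aA ua va.
have Am := admissible_midpoint K0 Au Av.
have am := le_trans aA (capacity_le Am).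
set w := fun p => _ in am; set e := fun p => _.
have : (energy e + energy e) + (energy w + energy w) = energy u + energy v.
  rewrite /energy -!esumD; first last.
  all: try by move=> p _; rewrite ?adde_ge0// lee_fin sqr_ge0.
  apply: eq_esum => p _; rewrite -!EFinD; congr EFin; rewrite /w /e.
  by field.
move=> E.
have ef : energy e \is a fin_num.
  rewrite ge0_fin_numE ?energy_ge0//.
  have : energy e <= energy u + energy v.
    rewrite -E -addeA leeDl// !adde_ge0// energy_ge0//.
  move=> /le_lt_trans; apply.
  by rewrite (le_lt_trans (leeD ua va))// -EFinD ltry.
have : (energy e + energy e) + ((a - d)%:E + (a - d)%:E) <= (a + d)%:E + (a + d)%:E.
  by rewrite (le_trans _ (leeD ua va))// -E leeD// leeD.
rewrite -(fineK ef) -!EFinD !lee_fin; lra.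
Qed.

End Capacity.

Lemma esum_exchange (R : realType) (I J : choiceType) (a : I -> J -> \bar R) :
  (forall i j, 0 <= a i j)%E ->
  (\esum_(i in setT) \esum_(j in setT) a i j =
   \esum_(j in setT) \esum_(i in setT) a i j)%E.
Proof.
have le (I' J' : choiceType) (b : I' -> J' -> \bar R) :
    (forall i j, 0 <= b i j)%E ->
    (\esum_(i in setT) \esum_(j in setT) b i j <=
     \esum_(j in setT) \esum_(i in setT) b i j)%E.
  move=> b0; apply: ge_ereal_sup => _ [F [finF _] <-].
  rewrite fsbig_finite//= -esum_sum//; apply: le_esum => j _.
  rewrite -(fsbig_finite _ _ finF).
  by apply: ereal_sup_ubound; exists F => //; split.
by move=> a0; apply/eqP; rewrite eq_le !le.
Qed.

(** Cauchy-Schwarz with the weights [2^-(j+1)], whose sum is at most 1. It bounds a telescoping sum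
    of increments by a weighted sum of their squares, uniformly in [J]. *)
Lemma sqr_sum_le_weighted (R : realType) (x : nat -> R) J :
  (\sum_(j < J) x j) ^+ 2 <= \sum_(j < J) 2 ^+ j.+1 * x j ^+ 2.
Proof.
elim: J x => [|J IH] x; first by rewrite !big_ord0 expr0n.
rewrite !big_ord_recl expr1.
have -> : \sum_(i < J) 2 ^+ (bump 0 i).+1 * x (bump 0 i) ^+ 2 =
    2 * \sum_(i < J) 2 ^+ i.+1 * x i.+1 ^+ 2.
  by rewrite big_distrr /=; apply: eq_bigr => i _; rewrite /bump add1n exprS mulrA.
have := IH (fun i => x i.+1).
set S := \sum_(j < J) x j.+1; set W := \sum_(j < J) _ * _.
have := sqr_ge0 (x 0%N - S).
rewrite /=; nra.
Qed.

Section CapacityLimit.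
Context {R : realType} {X : Type} {T : choiceType} (K : X -> T -> R).
Local Open Scope ereal_scope.

(** Near-minimizers [u j] for the sets [A_ (n j)] have fast decaying differences in energy. Rather
    than a limit, the proof builds one function [v] above all of them: it is then admissible for the
    union, and its energy exceeds the limit of the capacities by at most [e]. *)
Lemma capacity_bigcup (A_ : nat -> set X) (c : R) :
  (forall x p, 0 <= K x p)%R ->
  (forall n m, (n <= m)%N -> A_ n `<=` A_ m) ->
  (forall n, capacity K (A_ n) <= c%:E) ->
  capacity K (\bigcup_n A_ n) <= c%:E.
Proof.
move=> K0 A_mono A_c.
pose s := ereal_sup [set capacity K (A_ n) | n in setT].
have s_ub n : capacity K (A_ n) <= s by apply: ereal_sup_ubound; exists n.
have sc : s <= c%:E by apply: ge_ereal_sup => _ [n _ <-].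
have s0 : 0 <= s by apply: le_trans (s_ub 0%N); exact: capacity_ge0.
have sfin : s \is a fin_num by rewrite ge0_fin_numE// (le_lt_trans sc) ?ltry.
pose a := fine s; have sa : s = a%:E by rewrite fineK.
have a0 : (0 <= a)%R by rewrite -lee_fin -sa.
apply: le_trans sc; rewrite sa; apply/lee_addgt0Pr => e e0; rewrite -EFinD.
(* The final bound [(1 + h) * (a + h^2) + 8 * h^2 + 8 * h] is at most [a + h * (a + 18)] because
   [h <= 1]. *)
pose h : R := (Num.min 1 (e / (a + 18)))%R.
have h0 : (0 < h)%R by rewrite lt_min ltr01 divr_gt0//; lra.
have h1 : (h <= 1)%R by rewrite ge_min lexx.
have he : (h * (a + 18) <= e)%R.
  by rewrite -ler_pdivlMr ?ge_min ?lexx ?orbT//; lra.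
(* One factor [2^-(j+1)] absorbs the weight [2^j] in [G], the other makes the errors sum to at most
   [h^2]. *)
pose d j : R := (h ^+ 2 / (2 ^ j.+1)%:R / 2 ^+ j.+1)%R.
have d0 j : (0 < d j)%R.
  by rewrite !divr_gt0 ?exprn_gt0// ltr0n expn_gt0.
have dS j : (d j.+1 <= d j)%R.
  rewrite /d -!mulrA !ler_pM2l//; apply: ler_pM.
  - by rewrite invr_ge0 ler0n.
  - by rewrite invr_ge0 exprn_ge0.
  - by rewrite lef_pV2 ?posrE ?ltr0n ?expn_gt0// ler_nat leq_exp2l.
  - by rewrite lef_pV2 ?posrE ?exprn_gt0// ler_weXn2l ?ler1n.
have /choice[nu nuP] j : exists nu : nat * (T -> R),
    [/\ (j <= nu.1)%N, admissible K (A_ nu.1) nu.2,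
        energy nu.2 <= (a + d j)%:E & (a - d j)%:E <= capacity K (A_ nu.1)].
  have : (a - d j)%:E < s by rewrite sa lte_fin ltrBlDr ltrDl.
  move=> /ereal_sup_gt[_ [m _ <-] am].
  have : capacity K (A_ (maxn j m)) < (a + d j)%:E.
    by rewrite (le_lt_trans (s_ub _))// sa lte_fin ltrDl.
  move=> /ereal_inf_lt[_ [u uA <-] ua].
  exists (maxn j m, u); split => //=; [exact: leq_maxl|exact: ltW|].
  apply: le_trans (ltW am) (capacity_subset _ _).
  by apply: A_mono; exact: leq_maxr.
pose n j := (nu j).1; pose u j := (nu j).2.
have u0 j p : (0 <= u j p)%R by have [_ [+ _] _ _] := nuP j; exact.
pose df j p := ((u j p - u j.+1 p) / 2)%R.
have dfE j : energy (df j) <= (2 * d j)%:E.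
  have [_ uA1 uE1 c1] := nuP j; have [_ uA2 uE2 c2] := nuP j.+1.
  (* The indices [n j] need not increase, so the two functions are compared on the smaller of the
     two sets, whose capacity is still at least [a - d j]. *)
  apply: (@near_minimizers_close _ _ _ K (A_ (minn (n j) (n j.+1))) _ _ a) => //.
  - by apply: admissible_subset uA1; apply: A_mono; exact: geq_minl.
  - by apply: admissible_subset uA2; apply: A_mono; exact: geq_minr.
  - rewrite /minn; case: ifP => _ //; apply: le_trans c2.
    by rewrite lee_fin lerD2l lerN2.
  - by apply: le_trans uE2 _; rewrite lee_fin lerD2l.
pose G p := \sum_(0 <= j <oo) (2 ^+ j * df j p ^+ 2)%:E.
have df0 j p : 0 <= (2 ^+ j * df j p ^+ 2)%:E :> \bar R.
  by rewrite lee_fin mulr_ge0 ?sqr_ge0// exprn_ge0.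
have G0 p : 0 <= G p by apply: nneseries_ge0 => j _ _; exact: df0.
have GE : \esum_(p in setT) G p <= (h ^+ 2)%:E.
  under eq_esum do rewrite /G nneseries_esumT//.
  rewrite esum_exchange; last by move=> p j; exact: df0.
  apply: le_trans (epsilon_trick0 xpredT (sqr_ge0 h)).
  rewrite nneseries_esumT; last first.
    by move=> j; rewrite lee_fin divr_ge0 ?sqr_ge0.
  apply: le_esum => j _.
  under eq_esum do rewrite EFinM.
  apply: le_trans (esumZ_le _ _) _.
  - exact: exprn_ge0.
  - by move=> p; rewrite lee_fin sqr_ge0.
  - apply: le_trans (lee_wpmul2l _ (dfE j)) _; first by rewrite lee_fin exprn_ge0.
    rewrite -EFinM lee_fin /d (exprSr 2%R j).
    have p1 : (((2 ^ j.+1)%:R : R) != 0)%R by rewrite pnatr_eq0 expn_eq0.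
    have p2 : ((2 : R) ^+ j != 0)%R by rewrite expf_eq0 pnatr_eq0 andbF.
    move: p1 p2; set N := (_ %:R)%R; set M := (2 ^+ j)%R => p1 p2.
    rewrite le_eqVlt; apply/orP; left; apply/eqP; field.
    by rewrite p1 p2.
have Gfin p : G p \is a fin_num.
  rewrite ge0_fin_numE// (le_lt_trans _ (ltry (h ^+ 2)))// (le_trans _ GE)//.
  apply: esum_ge; exists [set p]; first by split.
  by rewrite fsbig_set1.
(* From [(x + S)^2 <= (1 + h) x^2 + (1 + 1/h) S^2] with [x = u 0 p] and [S] the sum of the
   [2 |df j p|]; weighted Cauchy-Schwarz gives [S^2 <= 8 G p]. *)
pose V p := ((1 + h) * u 0%N p ^+ 2 + 8 * (1 + h^-1) * fine (G p))%R.
have h'0 : (0 <= h^-1)%R by rewrite invr_ge0 ltW.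
have V0 p : (0 <= V p)%R.
  by rewrite addr_ge0// !mulr_ge0 ?addr_ge0 ?sqr_ge0 ?(ltW h0) ?fine_ge0.
pose v p := Num.sqrt (V p).
have uv J p : (u J p <= v p)%R.
  rewrite -[leLHS]ger0_norm// -sqrtr_sqr ler_wsqrtr//.
  have uJ : (u J p <= u 0%N p + \sum_(j < J) 2 * `|df j p|)%R.
    elim: J => [|J IH]; first by rewrite big_ord0 addr0.
    rewrite big_ord_recr/=.
    have : (u J.+1 p - u J p <= 2 * `|df J p|)%R.
      rewrite /df normrM distrC gtr0_norm ?invr_gt0//.
      by rewrite mulrC -mulrA mulVf// mulr1 ler_norm.
    move: IH; lra.
  have S8 : ((\sum_(j < J) 2 * `|df j p|) ^+ 2 <= 8 * fine (G p))%R.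
    apply: le_trans (sqr_sum_le_weighted (fun j => 2 * `|df j p|)%R J) _.
    have -> : (\sum_(j < J) 2 ^+ j.+1 * (2 * `|df j p|) ^+ 2 =
        8 * \sum_(j < J) 2 ^+ j * df j p ^+ 2)%R.
      rewrite big_distrr/=; apply: eq_bigr => j _.
      by rewrite exprMn real_normK ?num_real// exprS; ring.
    rewrite ler_pM2l// -lee_fin fineK// -sumEFin.
    have := @nneseries_lim_ge _ (fun j => (2 ^+ j * df j p ^+ 2)%:E) xpredT 0 J.
    by rewrite big_mkord; apply=> j _ _; exact: df0.
  have := u0 J p; have := u0 0%N p; move: uJ S8; rewrite /V.
  set S := (\sum_(j < J) _)%R; set g := fine _ => uJ S8 y0 z0.
  apply: (@le_trans _ _ ((u 0%N p + S) ^+ 2)%R); first by rewrite ler_sqr ?nnegrE//; lra.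
  apply: (@le_trans _ _ ((1 + h) * u 0%N p ^+ 2 + (1 + h^-1) * S ^+ 2)%R).
    rewrite -subr_ge0.
    have -> : ((1 + h) * u 0%N p ^+ 2 + (1 + h^-1) * S ^+ 2 - (u 0%N p + S) ^+ 2 =
       h^-1 * (h * u 0%N p - S) ^+ 2)%R by field; rewrite gt_eqF.
    by rewrite mulr_ge0 ?sqr_ge0.
  rewrite lerD2l [(8 * _)%R]mulrC -mulrA ler_wpM2l// addr_ge0//.
have vA : admissible K (\bigcup_n A_ n) v.
  split=> [p|x [m _ Amx]]; first exact: sqrtr_ge0.
  have [mn [_ uA] _ _] := nuP m.
  apply: le_trans (uA x _) _; first exact: (A_mono m).
  by apply: le_esum => p _; rewrite lee_fin ler_wpM2l//; exact: uv.
apply: le_trans (capacity_le vA) _.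
rewrite /energy.
under eq_esum do rewrite sqr_sqrtr// EFinD !EFinM fineK//.
rewrite esumD; last 2 first.
- by move=> p _; rewrite mule_ge0// ?lee_fin ?sqr_ge0// addr_ge0// ltW.
- by move=> p _; rewrite -EFinM mule_ge0// lee_fin mulr_ge0// addr_ge0.
have E1 : \esum_(p in setT) ((1 + h)%:E * (u 0%N p ^+ 2)%:E) <=
    ((1 + h) * (a + h ^+ 2))%:E.
  apply: le_trans (esumZ_le _ _) _.
  - by rewrite addr_ge0// ltW.
  - by move=> p; rewrite lee_fin sqr_ge0.
  - rewrite EFinM lee_wpmul2l// ?lee_fin ?addr_ge0// ?(ltW h0)//.
    have [_ _ uE _] := nuP 0%N; apply: le_trans uE _.
    rewrite lee_fin lerD2l /d expr1 expn1.
    by have := sqr_ge0 h; lra.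
have E2 : \esum_(p in setT) (8%:E * (1 + h^-1)%:E * G p) <=
    (8 * (1 + h^-1) * h ^+ 2)%:E.
  rewrite -EFinM; apply: le_trans (esumZ_le _ _) _.
  - by rewrite mulr_ge0// addr_ge0.
  - exact: G0.
  - by rewrite [leRHS]EFinM lee_wpmul2l// lee_fin mulr_ge0// addr_ge0.
apply: le_trans (leeD E1 E2) _; rewrite -EFinD lee_fin.
have -> : (8 * (1 + h^-1) * h ^+ 2 = 8 * h ^+ 2 + 8 * h)%R.
  by field; rewrite gt_eqF.
nra.
Qed.

End CapacityLimit.

(** * Measures of finite energy *)

Section QuadraticForm.
Context {R : realType} {V : finType} (G : V -> V -> R).
Implicit Types w : V -> R.

Definition quadratic w : R := \sum_x \sum_y w x * w y * G x y.

Definition simplex w : Prop := (forall x, 0 <= w x) /\ \sum_x w x = 1.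

Let point v : V -> R := fun x => (x == v)%:R.

Lemma sum_point (v : V) (f : V -> R) : \sum_x (x == v)%:R * f x = f v.
Proof.
rewrite (bigD1 v)//= eqxx mul1r big1 ?addr0// => x /negPf ->.
by rewrite mul0r.
Qed.

Lemma simplex_point v : simplex (point v).
Proof.
split=> [x|]; first by rewrite /point ler0n.
by rewrite -[RHS](sum_point v (fun=> 1)); apply: eq_bigr => x _; rewrite mulr1.
Qed.

Lemma quadratic_toward_point w v (t : R) : (forall x y, G x y = G y x) ->
  quadratic (fun x => (1 - t) * w x + t * point v x) =
  (1 - t) ^+ 2 * quadratic w + 2 * t * (1 - t) * (\sum_x w x * G v x) +
  t ^+ 2 * G v v.
Proof.
move=> Gsym; rewrite /quadratic.
transitivity (\sum_x ((1 - t) ^+ 2 * (\sum_y w x * w y * G x y) +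
    (1 - t) * t * (w x * G v x) +
    (x == v)%:R * ((1 - t) * t * (\sum_y w y * G v y) + t ^+ 2 * G v v))).
  apply: eq_bigr => x _.
  transitivity (\sum_y ((1 - t) ^+ 2 * (w x * w y * G x y) +
    (y == v)%:R * ((1 - t) * t * (w x * G x y) + (x == v)%:R * (t ^+ 2 * G x y)) +
    (x == v)%:R * ((1 - t) * t * (w y * G x y)))).
    by apply: eq_bigr => y _; rewrite /point; ring.
  rewrite !big_split/= -!mulr_sumr sum_point (Gsym x v).
  have [->|_] := eqVneq x v; rewrite [nat_of_bool _]/=; ring.
rewrite !big_split/= -!mulr_sumr sum_point; ring.
Qed.

(* Moving a minimizer of the form towards a point of the simplex cannot decrease
   the form; a near-minimizer gives the same up to a factor of 2. *)
Lemma quadratic_near_minimizer (v0 : V) :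
  (forall x y, G x y = G y x) -> (forall x y, 0 <= G x y) ->
  (forall x, 1 <= G x x) ->
  exists w, [/\ simplex w, 0 < quadratic w &
    forall v, quadratic w <= 2 * \sum_x w x * G v x].
Proof.
move=> Gsym G0 G1.
pose N : R := #|V|%:R.
have N0 : 0 < N by rewrite ltr0n; apply/card_gt0P; exists v0.
(* [G x x >= 1] and [y^2 >= 2 y / N - 1 / N^2]. A positive infimum is needed because the slack
   allowed to [w] below is a fraction of it. *)
have lbF w : simplex w -> N^-1 <= quadratic w.
  move=> [w0 w1].
  have : \sum_x (2 * N^-1 * w x - N^-1 ^+ 2) <= quadratic w.
    apply: ler_sum => x _; rewrite (bigD1 x)//= -[leLHS]addr0 lerD//; last first.
      by apply: sumr_ge0 => y _; rewrite !mulr_ge0.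
    apply: (@le_trans _ _ (w x ^+ 2)).
      by rewrite -subr_ge0 -[X in 0 <= X]addr0; have := sqr_ge0 (w x - N^-1); nra.
    by rewrite -expr2 ler_peMr ?sqr_ge0.
  rewrite big_split/= -mulr_sumr w1 sumr_const.
  rewrite -[X in _ + X]mulr_natr (_ : #|xpredT|%:R = N)// mulr1 expr2.
  by rewrite mulNr -mulrA mulVf ?gt_eqF// mulr1; lra.
pose E := [set quadratic w | w in simplex].
have hE : has_inf E.
  split.
    by exists (quadratic (point v0)); exists (point v0) => //; exact: simplex_point.
  by exists N^-1 => _ [w ws <-]; exact: lbF.
have El w : simplex w -> inf E <= quadratic w.
  by move=> ws; apply: ge_inf; [case: hE|exists w].
have E0 : 0 < inf E.
  apply: lt_le_trans (_ : N^-1 <= _); first by rewrite invr_gt0.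
  by apply: lb_le_inf; [case: hE|move=> _ [w ws <-]; exact: lbF].
pose M := \sum_x G x x.
have GM v : G v v <= M.
  rewrite /M (bigD1 v)//= lerDl sumr_ge0//.
have M0 : 0 < M by apply: lt_le_trans (GM v0); exact: lt_le_trans (G1 v0).
have EM : inf E <= M.
  apply: le_trans (El _ (simplex_point v0)) _; apply: le_trans (GM v0).
  rewrite /quadratic le_eqVlt; apply/orP; left; apply/eqP.
  under eq_bigr do under eq_bigr do rewrite -mulrA.
  under eq_bigr do rewrite -mulr_sumr sum_point.
  by rewrite sum_point.
(* Chosen so that [t * G v v <= inf E / 2]. If the claim failed at [v], a move of length [t] towards
   [v] would lower the form by at least [t * inf E / 2], more than the slack of [w]. *)
pose t := inf E / (2 * M).
have tM : t * M = inf E / 2 by rewrite /t; field; rewrite gt_eqF.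
have t0 : 0 < t by rewrite divr_gt0// mulr_gt0.
have t1 : t <= 1 by rewrite ler_pdivrMr ?mulr_gt0//; lra.
have [_ [w ws <-] wE] : exists2 y, E y & y < inf E + t * inf E / 2.
  by apply: inf_adherent => //; rewrite divr_gt0// mulr_gt0.
exists w; split => //; first exact: lt_le_trans (El _ ws).
move=> v; rewrite leNgt; apply/negP => Gv.
have [w0 w1] := ws.
have ws' : simplex (fun x => (1 - t) * w x + t * point v x).
  have [p0 p1] := simplex_point v.
  split=> [x|]; first by rewrite addr_ge0// mulr_ge0// ?subr_ge0// ltW.
  by rewrite big_split/= -!mulr_sumr w1 p1; ring.
have := El _ ws'; rewrite quadratic_toward_point//.
have tMv : t * G v v <= inf E / 2 by rewrite -tM ler_pM2l.
have := El _ ws.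
set F := quadratic w in Gv wE *; set S := \sum_x _ in Gv *; set g := G v v in tMv *.
set e := inf E in wE tMv E0 *.
move=> eF.
have h1 : 0 <= (1 - t) * t by rewrite mulr_ge0// ?subr_ge0// ltW.
have h2 : 2 * t * (1 - t) * S <= (1 - t) * t * F.
  rewrite (_ : 2 * t * (1 - t) * S = (1 - t) * t * (2 * S)); last by ring.
  by rewrite ler_wpM2l// ltW.
have h3 : t ^+ 2 * g <= t * (e / 2) by rewrite expr2 -mulrA ler_pM2l.
have h4 : t * e <= t * F by rewrite ler_pM2l.
have h5 : (1 - t) ^+ 2 * F + (1 - t) * t * F = F - t * F by ring.
by lra.
Qed.

End QuadraticForm.

Section LevelSums.
Context {R : realType} {I : choiceType} (k : nat -> I).
Local Open Scope ereal_scope.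

Lemma esum_level (a : nat -> \bar R) : (forall j, 0 <= a j) ->
  \esum_(p in [set: nat * I]) (if p.2 == k p.1 then a p.1 else 0) =
  \sum_(0 <= j <oo) a j.
Proof.
move=> a0; rewrite nneseries_esumT//.
pose D := [set p : nat * I | p.2 = k p.1].
transitivity (\esum_(p in D) a p.1).
  rewrite [RHS]esum_mkcond; apply: eq_esum => p _.
  by rewrite (_ : (p \in D) = (p.2 == k p.1))//; apply/idP/eqP; rewrite inE.
rewrite (@reindex_esum _ _ _ setT D (fun j => (j, k j)))//.
split => //.
- by move=> j j' jT j'T [].
- by move=> [j i] ji; exists j; rewrite -?ji.
Qed.

Lemma esum_level_fin (a : nat -> \bar R) m : (forall j, 0 <= a j) ->
  \esum_(p in [set: nat * I])
     (if (p.1 < m)%N && (p.2 == k p.1) then a p.1 else 0) =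
  \sum_(j < m) a j.
Proof.
move=> a0.
transitivity (\esum_(p in [set: nat * I])
    (if p.2 == k p.1 then (if (p.1 < m)%N then a p.1 else 0) else 0)).
  by apply: eq_esum => p _; case: (p.1 < m)%N; case: (p.2 == _).
rewrite (esum_level (a := fun j => if (j < m)%N then a j else 0)); last first.
  by move=> j; case: ifP.
rewrite (nneseries_split 0 m); last by move=> j _; case: ifP.
rewrite add0n eseries0 ?adde0; last by move=> j mj _; rewrite ltnNge mj.
by rewrite big_mkord; apply: eq_bigr => j _; rewrite ltn_ord.
Qed.

End LevelSums.

Section LevelKernel.
Context {R : realType} {X : Type} {I : choiceType} (q : nat -> X -> I) (b : R).
Hypothesis b0 : 0 < b.

Let al := (Num.sqrt b)^-1.

(** Pairing the rows of [x] and [y] gives the sum of [b^-j] over the levels [j] with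
    [q j x = q j y]. For [b = 2^-s] and dyadic cubes this is the dyadic form of the Riesz kernel
    [|x - y|^-s]. *)
Definition level_kernel (x : X) (p : nat * I) : R :=
  (Num.sqrt b)^-1 ^+ p.1 * (p.2 == q p.1 x)%:R.

Lemma level_kernel_ge0 x p : 0 <= level_kernel x p.
Proof. by rewrite mulr_ge0// exprn_ge0// invr_ge0 sqrtr_ge0. Qed.

Let al2 j : al ^+ j * al ^+ j = b^-1 ^+ j.
Proof. by rewrite -exprMn /al -invfM -expr2 sqr_sqrtr ?ltW. Qed.

Let al0 j : 0 <= al ^+ j.
Proof. by rewrite exprn_ge0// invr_ge0 sqrtr_ge0. Qed.

Let bV0 j : 0 <= b^-1 ^+ j.
Proof. by rewrite exprn_ge0// invr_ge0 ltW. Qed.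

(** Duality of capacity and energy. Let [w] be a near-minimizer of the energy form [G], of energy
    [l]. The function [u] that carries the cell masses of [2 w / l] has sums at least 1 on [A] and
    energy [4 / l], so the capacity bound forces [c < 4 / l]. The hypothesis on [key] makes [A]
    finite as far as levels up to [n] can tell. *)
Lemma capacity_gt_measure (A : set X) (c : R) n (Phi : finType) (key : X -> Phi) :
  0 < c -> (c%:E < capacity level_kernel A)%E ->
  (forall x y, A x -> A y -> key x = key y ->
    forall j, (j <= n)%N -> q j x = q j y) ->
  exists (r : Phi -> X) (w : Phi -> R),
    [/\ forall v, A (r v), forall v, 0 <= w v, \sum_v w v = 1 &
      \sum_(j < n.+1) b^-1 ^+ j *
        (\sum_v \sum_v' w v * w v' * (q j (r v) == q j (r v'))%:R) <= 4 / c].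
Proof.
move=> c0 cA keyP.
have [a0 Aa0] : A !=set0.
  apply/set0P/eqP => A0; move: cA; rewrite ltNge => /negP; apply.
  have : admissible level_kernel A (fun=> 0) by split=> // x; rewrite A0.
  move=> /capacity_le /le_trans; apply.
  rewrite /energy esum1 ?lee_fin ?ltW// => p _.
  by rewrite expr0n.
(* Keys that no point of [A] attains are sent to the arbitrary point [a0]. *)
have /choice[r rP] (v : Phi) : exists x, A x /\
    forall y, A y -> key y = v -> key x = v.
  have [[y [Ay yv]]|nv] := pselect (exists y, A y /\ key y = v).
    by exists y; split.
  by exists a0; split=> // y Ay yv; exfalso; apply: nv; exists y.
have rA v : A (r v) by have [] := rP v.
have rkey x j : A x -> (j <= n)%N -> q j x = q j (r (key x)).
  move=> Ax jn; apply: keyP => //; have [_ h] := rP (key x).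
  by rewrite (h x).
pose G (v v' : Phi) := \sum_(j < n.+1) b^-1 ^+ j * (q j (r v) == q j (r v'))%:R.
have G0 v v' : 0 <= G v v' by apply: sumr_ge0 => j _; rewrite mulr_ge0.
have [w [[w0 w1] l0 wG]] : exists w, [/\ simplex w, 0 < quadratic G w &
    forall v, quadratic G w <= 2 * \sum_x w x * G v x].
  apply: (quadratic_near_minimizer (key a0)) => //.
  - by move=> v v'; apply: eq_bigr => j _; rewrite eq_sym.
  - move=> v; rewrite /G big_ord_recl expr0 eqxx mulr1 lerDl sumr_ge0// => j _.
    by rewrite mulr_ge0.
set l := quadratic G w in l0 wG.
have lE : l = \sum_(j < n.+1) b^-1 ^+ j *
    (\sum_v \sum_v' w v * w v' * (q j (r v) == q j (r v'))%:R).
  rewrite /l /quadratic.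
  under [RHS]eq_bigr do rewrite big_distrr/=.
  rewrite [RHS]exchange_big/=; apply: eq_bigr => v _.
  under [RHS]eq_bigr do rewrite big_distrr/=.
  rewrite [RHS]exchange_big/=; apply: eq_bigr => v' _.
  rewrite /G big_distrr/=; apply: eq_bigr => j _; ring.
exists r, w; split => //; rewrite -lE.
pose u (p : nat * I) := if (p.1 < n.+1)%N then
  al ^+ p.1 * (2 / l * \sum_v w v * (p.2 == q p.1 (r v))%:R) else 0.
have u0 p : 0 <= u p.
  rewrite /u; case: ifP => // _; rewrite mulr_ge0// mulr_ge0 ?divr_ge0 ?(ltW l0)//.
  by apply: sumr_ge0 => v _; rewrite mulr_ge0.
have uA : admissible level_kernel A u.
  split=> // x Ax.
  pose s j := \sum_v w v * (q j x == q j (r v))%:R.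
  have s0 j : 0 <= s j by apply: sumr_ge0 => v _; rewrite mulr_ge0.
  rewrite [leRHS](_ : _ = \sum_(j < n.+1) (b^-1 ^+ j * (2 / l * s j))%:E)%E; last first.
    rewrite -(esum_level_fin (fun j => q j x)
      (a := fun j => (b^-1 ^+ j * (2 / l * s j))%:E)); last first.
      by move=> j; rewrite lee_fin !mulr_ge0// invr_ge0 ltW.
    apply: eq_esum => -[j i] _ /=; rewrite /level_kernel /u /=.
    case: ifPn => jn /=; last by rewrite mulr0.
    have [->|_] := eqVneq i (q j x); last by rewrite mulr0 mul0r.
    by congr EFin; rewrite -/al mulr1 -al2 -[RHS]mulrA.
  rewrite sumEFin lee_fin.
  rewrite [leRHS](_ : _ = l^-1 * (2 * \sum_v w v * G (key x) v)).
    by rewrite ler_pdivlMl// mulr1; exact: wG.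
  transitivity (l^-1 * (2 * \sum_(j < n.+1) b^-1 ^+ j * s j)).
    rewrite !big_distrr/=; apply: eq_bigr => j _; ring.
  congr (_ * (_ * _)).
  under eq_bigr do rewrite /s big_distrr/=.
  rewrite exchange_big/=; apply: eq_bigr => v _.
  rewrite /G big_distrr/=; apply: eq_bigr => j _.
  rewrite (rkey x)//; last by rewrite -ltnS.
  ring.
have uE : (energy u <= (4 / l)%:E)%E.
  pose f (v v' : Phi) j := (4 / l ^+ 2 *
    (b^-1 ^+ j * (w v * w v' * (q j (r v) == q j (r v'))%:R)))%:E.
  have f0 v v' j : (0 <= f v v' j)%E.
    by rewrite lee_fin !mulr_ge0 ?invr_ge0 ?sqr_ge0.
  rewrite /energy [leLHS](_ : _ = \esum_(p in setT) (\sum_v \sum_v'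
      (if (p.1 < n.+1)%N && (p.2 == q p.1 (r v)) then f v v' p.1 else 0)))%E; last first.
    apply: eq_esum => -[j i] _ /=; rewrite /u /=; case: ifPn => jn /=; last first.
      by rewrite expr0n/= big1// => v _; rewrite big1.
    transitivity ((4 / l ^+ 2 * (b^-1 ^+ j * \sum_v \sum_v'
        (w v * (i == q j (r v))%:R) * (w v' * (i == q j (r v'))%:R)))%:E).
      congr EFin; rewrite -big_distrlr/= -al2.
      by rewrite !expr2 invfM; ring.
    rewrite 2!big_distrr/= -sumEFin; apply: eq_bigr => v _.
    rewrite 2!big_distrr/= -sumEFin; apply: eq_bigr => v' _.
    rewrite /f; have [->|_] := eqVneq i (q j (r v)).
      by congr EFin; rewrite mulr1; congr (_ * (_ * _)); ring.
    by rewrite !(mulr0, mul0r).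
  rewrite esum_sum; last first.
    by move=> p v _ _; apply: sume_ge0 => v' _; case: ifP.
  under eq_bigr => v _.
    rewrite esum_sum; last by move=> p v' _ _; case: ifP.
    under eq_bigr => v' _ do rewrite (esum_level_fin (fun j => q j (r v)))//.
    over.
  rewrite /= le_eqVlt; apply/orP; left; apply/eqP.
  rewrite /f; under eq_bigr => v _.
    under eq_bigr => v' _ do rewrite sumEFin.
    rewrite sumEFin; over.
  rewrite sumEFin; congr EFin.
  transitivity (4 / l ^+ 2 * l); last by rewrite expr2 invfM; field; rewrite gt_eqF.
  rewrite {2}/l /quadratic big_distrr/=; apply: eq_bigr => v _.
  rewrite big_distrr/=; apply: eq_bigr => v' _.
  rewrite /G !big_distrr/=; apply: eq_bigr => j _; ring.
have : c < 4 / l.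
  by rewrite -lte_fin; apply: lt_le_trans cA _; exact: le_trans (capacity_le uA) uE.
rewrite ltr_pdivlMr// => cl; rewrite ler_pdivlMr//; rewrite mulrC; exact: ltW.
Qed.

End LevelKernel.

(** * Capacity and Hausdorff measure *)

Section Diameters.
Context {R : realType} {X : Type} (d : X -> X -> R).
Local Open Scope ereal_scope.
Implicit Types (A : set X) (s c : R).

Lemma diameter_ge0 A : 0 <= diameter d A.
Proof. by apply: ereal_sup_ubound; left. Qed.

Lemma diameter_le A c : (0 <= c)%R ->
  (forall x y, A x -> A y -> d x y <= c)%R -> diameter d A <= c%:E.
Proof.
move=> c0 Ac; apply: ge_ereal_sup => _ [->|[[x y] /= [Ax Ay] <-]].
  by rewrite lee_fin.
by rewrite lee_fin; exact: Ac.
Qed.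

Lemma dist_le_diameter A c x y :
  diameter d A <= c%:E -> A x -> A y -> (d x y <= c)%R.
Proof.
move=> Ac Ax Ay; rewrite -lee_fin; apply: le_trans Ac.
by apply: ereal_sup_ubound; right; exists (x, y).
Qed.

Lemma diameter_pow_ge0 s A : 0 <= diameter_pow d s A.
Proof. by rewrite /diameter_pow; case: ifP => // _; exact: poweR_ge0. Qed.

Lemma diameter_pow_le A s c : (0 <= s)%R -> (0 <= c)%R ->
  (forall x y, A x -> A y -> d x y <= c)%R ->
  diameter_pow d s A <= (c `^ s)%:E.
Proof.
move=> s0 c0 Ac; rewrite /diameter_pow; case: ifP => _.
  by rewrite lee_fin powR_ge0.
rewrite -poweR_EFin; apply: gt0_ler_poweR => //.
- by rewrite in_itv/= diameter_ge0 leey.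
- by rewrite in_itv/= lee_fin c0 leey.
- exact: diameter_le.
Qed.

Lemma hausdorff_content_ge0 s c A : 0 <= hausdorff_content d s c A.
Proof.
apply/ereal_infP => _ [E _ <-]; apply: nneseries_ge0 => i _ _.
exact: diameter_pow_ge0.
Qed.

Lemma hausdorff_measure_eq0 s A :
  (forall c e : R, (0 < c)%R -> (0 < e)%R -> hausdorff_content d s c A <= e%:E) ->
  hausdorff_measure d s A = 0.
Proof.
move=> h; apply/eqP; rewrite eq_le; apply/andP; split.
  apply: ge_ereal_sup => _ [c c0 <-]; apply/lee_addgt0Pr => e e0.
  by rewrite add0e; exact: h.
apply: le_trans (hausdorff_content_ge0 s 1 A) _.
by apply: ereal_sup_ubound; exists 1%R => //=.
Qed.

Lemma hausdorff_content_eq0 s A c : (0 < c)%R ->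
  hausdorff_measure d s A = 0 -> hausdorff_content d s c A = 0.
Proof.
move=> c0 A0; apply/eqP; rewrite eq_le hausdorff_content_ge0 andbT -A0.
by apply: ereal_sup_ubound; exists c.
Qed.

End Diameters.

Lemma nneseries_pickle (R : realType) (T : countType) (g : T -> \bar R) :
  (forall p, 0 <= g p)%E ->
  (\sum_(0 <= m <oo) oapp g 0%E (pickle_inv m) = \esum_(p in setT) g p)%E.
Proof.
move=> g0.
have h0 m : (0 <= oapp g 0%E (pickle_inv m))%E by case: (pickle_inv m) => /=.
rewrite nneseries_esumT//.
pose D := range (@pickle T).
transitivity (\esum_(m in D) oapp g 0%E (pickle_inv m)).
  rewrite [RHS]esum_mkcond; apply: eq_esum => m _.
  case: ifPn => // mD; case E : (pickle_inv m) => [p|]//=.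
  by exfalso; move/negP: mD; apply; rewrite inE; exists p => //;
    have := @pickle_invK T m; rewrite E.
rewrite (@reindex_esum R T nat setT D pickle).
  by apply: eq_esum => p _; rewrite pickleK_inv.
split => [x _|x y _ _ xy|_ [x _ <-]]; [by exists x| |by exists x].
by apply: Some_inj; rewrite -!pickleK_inv xy.
Qed.

Lemma sum_expr_le (R : realType) (x : R) n : 0 <= x -> x < 1 ->
  \sum_(j < n) x ^+ j <= (1 - x)^-1.
Proof.
move=> x0 x1; have x1' : 0 < 1 - x by rewrite subr_gt0.
rewrite -[leRHS]mul1r ler_pdivlMr//.
have -> : (\sum_(j < n) x ^+ j) * (1 - x) = 1 - x ^+ n.
  elim: n => [|n IH]; first by rewrite big_ord0 mul0r expr0 subrr.
  by rewrite big_ord_recr/= mulrDl IH exprS; ring.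
by rewrite lerBlDr lerDl exprn_ge0.
Qed.

Section CapacityHausdorff.
Context {R : realType} {X : Type} {I : countType} (d : X -> X -> R).
Variables (q : nat -> X -> I) (b s C : R).
Hypotheses (s0 : 0 < s) (C0 : 0 < C) (b1 : b < 1) (sb : 2^-1 `^ s < b).
Hypothesis d_le : forall j x y, q j x = q j y -> d x y <= C * 2^-1 ^+ j.

Let b' := 2^-1 `^ s.
Let b'0 : 0 < b'. Proof. by rewrite powR_gt0// invr_gt0. Qed.
Let b0 : 0 < b. Proof. exact: lt_trans sb. Qed.

Lemma powR_level j : (C * 2^-1 ^+ j) `^ s = C `^ s * b' ^+ j.
Proof.
rewrite powRM ?(ltW C0) ?exprn_ge0 ?invr_ge0//; congr (_ * _).
by rewrite -!powR_mulrn ?powR_ge0 ?invr_ge0// powRAC.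
Qed.

(* If a potential is at least 1 at x then some level carries at least the
   fraction theta^j of it, and these cells form an efficient cover. *)
Lemma hausdorff_measure0_capacity (A : set X) :
  (forall c : R, 0 < c -> ~ (c%:E < capacity (level_kernel q b) A)%E) ->
  hausdorff_measure d s A = 0%E.
Proof.
move=> A0; apply: hausdorff_measure_eq0 => dl e dl0 e0.
(* [b' = 2^-s] is the cost of one level and [b] its weight in the kernel; [sb] says that the ratio
   is below 1. *)
pose th := Num.sqrt (b' / b).
have th2 : th ^+ 2 = b' / b by rewrite sqr_sqrtr// divr_ge0 ?ltW.
have th0 : 0 < th by rewrite sqrtr_gt0 divr_gt0.
have th1 : th < 1.
  by rewrite -[ltRHS]sqrtr1 ltr_sqrt ?ltr01// ltr_pdivrMr ?mul1r.
(* The thresholds [ka * th^j] sum to at most 1/2, so a point outside all cells of [D] would have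
   potential below 1. *)
pose ka := (1 - th) / 2.
have ka0 : 0 < ka by rewrite divr_gt0 ?subr_gt0.
have Cs0 : 0 < C `^ s by rewrite powR_gt0.
(* The first bound controls the whole sum. The second controls each term, hence keeps every diameter
   below [dl]. *)
pose ep := Num.min (e / C `^ s) (dl `^ s / C `^ s).
have ep0 : 0 < ep by rewrite lt_min !divr_gt0 ?powR_gt0.
have [u [u0 uA] uE] : exists2 u, admissible (level_kernel q b) A u &
    (energy u < (ka ^+ 2 * ep)%:E)%E.
  have k0 : 0 < ka ^+ 2 * ep by rewrite mulr_gt0 ?exprn_gt0.
  have : (capacity (level_kernel q b) A < (ka ^+ 2 * ep)%:E)%E.
    rewrite (@le_lt_trans _ _ (ka ^+ 2 * ep / 2)%:E)//.
      rewrite leNgt; apply/negP; apply: A0; exact: divr_gt0.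
    by rewrite lte_fin; lra.
  by move=> /ereal_inf_lt[_ [u uA <-] ue]; exists u.
pose al := (Num.sqrt b)^-1.
have al0 : 0 < al by rewrite invr_gt0 sqrtr_gt0.
have al2 j : b' ^+ j = th ^+ j ^+ 2 / al ^+ j ^+ 2.
  rewrite -!exprM ![(j * 2)%N]mulnC !exprM th2 /al exprVn sqr_sqrtr ?ltW//.
  by rewrite -exprVn invrK -exprMn divfK// gt_eqF.
(* On these cells [b'^j <= u^2 / ka^2], so the energy of [u] pays for the cover. *)
pose D := [set p : nat * I | ka * th ^+ p.1 <= al ^+ p.1 * u p].
have Du p : D p -> b' ^+ p.1 <= (ka ^+ 2)^-1 * u p ^+ 2.
  rewrite /D/= => Dp; rewrite al2 ler_pdivrMr ?exprn_gt0//.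
  rewrite -mulrA ler_pdivlMl ?exprn_gt0// -!exprMn ler_sqr ?nnegrE.
  - by rewrite [u p * _]mulrC.
  - by rewrite mulr_ge0 ?exprn_ge0 ?ltW.
  - by rewrite mulr_ge0 ?exprn_ge0 ?(ltW al0).
pose g p : \bar R := if p \in D then (C `^ s * b' ^+ p.1)%:E else 0%E.
have g0 p : (0 <= g p)%E.
  rewrite /g; case: ifP => // _; rewrite lee_fin mulr_ge0 ?powR_ge0//.
  by rewrite exprn_ge0// ltW.
have gE : (\esum_(p in setT) g p <= (C `^ s * ep)%:E)%E.
  apply: (@le_trans _ _ (\esum_(p in setT)
      ((C `^ s / ka ^+ 2)%:E * (u p ^+ 2)%:E)%E)).
    apply: le_esum => p _; rewrite /g; case: ifPn => [|_].
      by rewrite inE => /Du h; rewrite -EFinM lee_fin -mulrA ler_pM2l.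
    by rewrite -EFinM lee_fin mulr_ge0 ?sqr_ge0// divr_ge0 ?sqr_ge0// powR_ge0.
  have c0 : 0 <= C `^ s / ka ^+ 2 by rewrite divr_ge0 ?sqr_ge0// powR_ge0.
  apply: le_trans (esumZ_le c0 _) _.
    by move=> p; rewrite lee_fin sqr_ge0.
  apply: le_trans (lee_wpmul2l _ (ltW uE)) _; first by rewrite lee_fin.
  rewrite -EFinM lee_fin -mulrA ler_pM2l// mulrA mulVf ?mul1r//.
  by rewrite gt_eqF// exprn_gt0.
have Dlevel p : D p -> C `^ s * b' ^+ p.1 <= C `^ s * ep.
  move=> Dp; rewrite -lee_fin; apply: le_trans gE.
  apply: esum_ge; exists [set p]; first by split.
  by rewrite fsbig_set1 /g mem_set.
pose cell (p : nat * I) : set X := if p \in D then [set x | q p.1 x = p.2] else set0.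
pose E m : set X := oapp cell set0 (pickle_inv m).
have cell_le p x y : cell p x -> cell p y -> d x y <= C * 2^-1 ^+ p.1.
  by rewrite /cell; case: ifP => // _ /= xp yp; apply: d_le; rewrite xp.
have lev0 j : 0 <= C * 2^-1 ^+ j.
  by rewrite mulr_ge0 ?(ltW C0)// exprn_ge0// invr_ge0.
apply: (@le_trans _ _ (\sum_(0 <= i <oo) diameter_pow d s (E i))%E).
  apply: ereal_inf_lbound; exists E => //; split.
    move=> x Ax; apply: contrapT => nx.
    have {}nx j : al ^+ j * u (j, q j x) < ka * th ^+ j.
      rewrite ltNge; apply/negP => jx; apply: nx.
      exists (pickle (j, q j x)) => //; rewrite /E pickleK_inv/= /cell mem_set//.
    have := uA _ Ax; rewrite leNgt => /negP; apply.
    rewrite (_ : esum _ _ = \sum_(0 <= j <oo) (al ^+ j * u (j, q j x))%:E)%E; last first.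
      rewrite -(esum_level (fun j => q j x)
          (a := fun j => (al ^+ j * u (j, q j x))%:E)).
        apply: eq_esum => -[j i] _ /=; rewrite /level_kernel/=.
        by case: eqVneq => [->|_]; rewrite ?mulr1 ?mulr0 ?mul0r.
      by move=> j; rewrite lee_fin mulr_ge0// exprn_ge0// ltW.
    apply: (@le_lt_trans _ _ (2^-1)%:E); last first.
      by rewrite lte_fin invf_lt1// ltr1n.
    apply: lime_le.
      apply: is_cvg_nneseries => j _ _; rewrite lee_fin mulr_ge0// exprn_ge0//.
      exact: ltW.
    apply: nearW => n; rewrite sumEFin lee_fin big_mkord.
    apply: (@le_trans _ _ (\sum_(j < n) ka * th ^+ j)).
      by apply: ler_sum => j _; exact: ltW.
    rewrite -mulr_sumr; apply: (@le_trans _ _ (ka * (1 - th)^-1)).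
      by rewrite ler_pM2l// sum_expr_le// ltW.
    rewrite le_eqVlt; apply/orP; left; apply/eqP; rewrite /ka; field.
    by rewrite gt_eqF// subr_gt0.
  move=> m; apply: diameter_le; first exact: ltW.
  rewrite /E; case: (pickle_inv m) => [p|]//= x y xp yp.
  have Dp : D p by move: xp; rewrite /cell; case: ifPn => //; rewrite inE.
  apply: le_trans (cell_le _ _ _ xp yp) _.
  rewrite leNgt; apply/negP => /(gt0_ltr_powR s0).
  rewrite !nnegrE lev0 (ltW dl0) => /(_ isT isT); apply/negP; rewrite -leNgt.
  rewrite powR_level; apply: le_trans (Dlevel _ Dp) _.
  rewrite mulrC -ler_pdivlMr// /ep ge_min lexx orbT//.
apply: (@le_trans _ _ (\sum_(0 <= i <oo) oapp g 0%E (pickle_inv i))%E).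
  apply: lee_nneseries; first by move=> i _ _; exact: diameter_pow_ge0.
  move=> i _; rewrite /E; case: (pickle_inv i) => [p|]/=; last first.
    by rewrite /diameter_pow eqxx.
  rewrite /g; case: ifPn => [pD|npD]; last first.
    by rewrite /cell (negPf npD) /diameter_pow eqxx.
  rewrite -powR_level; apply: diameter_pow_le; first exact: ltW.
    exact: lev0.
  exact: cell_le.
rewrite nneseries_pickle//; apply: le_trans gE _.
by rewrite lee_fin mulrC -ler_pdivlMr// /ep ge_min lexx.
Qed.

End CapacityHausdorff.

(** * Compactness in Baire space *)

Definition baire_box (k : nat -> nat) n : set baire_space :=
  [set x | forall i, (i < n)%N -> (x i <= k i)%N].

Lemma baire_cvg (z : nat -> baire_space) (y : baire_space) :
  (forall m j, (j < m)%N -> z m j = y j) -> z @ \oo --> y.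
Proof.
move=> zy; apply/cvg_sup => i A.
rewrite nbhsE => -[B [[V oV <-] yV] BA].
exists i.+1 => // m /= im; apply: BA; rewrite /= zy//.
Qed.

Lemma compact_baire_box (k : nat -> nat) :
  compact [set x : baire_space | forall i, (x i <= k i)%N].
Proof.
apply: (@tychonoff nat (fun=> nat) (fun i => [set m | (m <= k i)%N])) => i.
by apply: finite_compact; exact: (finite_II (k i).+1).
Qed.

Lemma nbhs_baire_cylinder (z : baire_space) m :
  nbhs z [set w : baire_space | forall j, (j < m)%N -> w j = z j].
Proof.
elim: m => [|m IH]; first by apply: filterS filterT => w _ j.
have zm : nbhs z ((fun w : baire_space => w m) @^-1` [set z m]).
  apply: (@proj_continuous nat (fun=> nat) m z); exact: discrete_set1.
apply: filterS (filterI IH zm) => w [/= wz wm] j.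
by rewrite ltnS leq_eqVlt => /predU1P[->|/wz].
Qed.

(** The sets [baire_box k n] are not compact, since coordinates from [n] on are free. If each
    contained a bad point [x n], replacing these coordinates by 0 would give points [y n] in a
    compact product. Near a cluster point [z], membership in the open set around [f z] depends on
    finitely many coordinates, and there [x n] agrees with [y n]. *)
Lemma baire_box_cover (T : topologicalType) (f : baire_space -> T) (k : nat -> nat)
    (O : nat -> set T) :
  continuous f -> (forall i, open (O i)) -> range f `<=` \bigcup_i O i ->
  exists n, f @` baire_box k n `<=` \bigcup_(i < n) O i.
Proof.
move=> cf oO fO; apply: contrapT => no_n.
have /choice[x xP] n : exists x, baire_box k n x /\ ~ (\bigcup_(i < n) O i) (f x).
  apply: contrapT => nx; apply: no_n; exists n => _ [x xn <-].
  by apply: contrapT => fx; apply: nx; exists x.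
pose y n : baire_space := fun i => if (i < n)%N then x n i else 0%N.
have yk n i : (y n i <= k i)%N.
  by rewrite /y; case: ifPn => // ni; have [/(_ i ni)] := xP n.
have yoo : (y @ \oo) [set x : baire_space | forall i, (x i <= k i)%N].
  by exists 0%N => // n _; exact: yk.
have [z [_ zcl]] := @compact_baire_box k (y @ \oo) _ yoo.
have [i _ fzi] : (\bigcup_i O i) (f z) by apply: fO; exists z.
have nV : nbhs z (f @^-1` O i).
  by apply: cf; apply: open_nbhs_nbhs; split.
have [m mV] : exists m, forall w : baire_space,
    (forall j, (j < m)%N -> w j = z j) -> O i (f w).
  apply: contrapT => no_m.
  have /choice[w wP] m : exists w : baire_space,
      (forall j, (j < m)%N -> w j = z j) /\ ~ O i (f w).
    apply: contrapT => nw; apply: no_m; exists m => w wz.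
    by apply: contrapT => nOw; apply: nw; exists w.
  have /(_ _ nV)[m _ mV] := baire_cvg (fun m => proj1 (wP m)).
  by apply: (proj2 (wP m)); apply: mV => /=.
(* An index beyond [m + i] serves twice: the first [m] coordinates of [x n] are not truncated, and
   [O i] is among the sets that [x n] avoids. *)
have [|_ [/= [n nmi <-] nz]] := zcl [set y n | n in [set n | (m + i < n)%N]] _ _
    (nbhs_baire_cylinder z m).
  by exists (m + i).+1 => // n /= mn; exists n.
case: (xP n) => _; apply; exists i => /=.
  by rewrite (leq_ltn_trans _ nmi)// leq_addl.
apply: mV => j jm; rewrite -nz// /y ifT//.
by rewrite (ltn_trans jm)// (leq_ltn_trans _ nmi)// leq_addr.
Qed.

Section BaireCapacity.
Context {R : realType} {X : Type} {T : choiceType} (K : X -> T -> R).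
Local Open Scope ereal_scope.

(** The bounds [k i] are chosen one at a time: a box is the increasing union of its restrictions by
    [x_i <= m], and by [capacity_bigcup] these cannot all have capacity at most [c]. The same [c]
    survives every step, so no constants accumulate. *)
Lemma capacity_baire_box (f : baire_space -> X) (A : set X) (c : R) :
  (forall x p, 0 <= K x p)%R -> c%:E < capacity K (range f `&` A) ->
  exists k, forall n, c%:E < capacity K (f @` baire_box k n `&` A).
Proof.
move=> K0 cfA.
pose S (s : seq nat) := f @` baire_box (nth 0%N s) (size s) `&` A.
have step s : exists m, c%:E < capacity K (S s) ->
    c%:E < capacity K (S (rcons s m)).
  have [cs|cs] := boolP (c%:E < capacity K (S s)); last by exists 0%N.
  apply: contrapT => nm; move: cs; apply/negP; rewrite -leNgt.
  have -> : S s = \bigcup_m S (rcons s m).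
    rewrite /S; apply/seteqP; split => [_ [ [x xs <-] Ax]|_ [m _ [ [x xs <-] Ax]]].
      exists (x (size s)) => //; split=> //; exists x => // i.
      rewrite size_rcons ltnS leq_eqVlt => /predU1P[->|si].
        by rewrite nth_rcons ltnn eqxx.
      by rewrite nth_rcons si; exact: xs.
    split=> //; exists x => // i si.
    by have := xs i; rewrite size_rcons nth_rcons si; apply; exact: ltnW.
  apply: capacity_bigcup => // [m m' mm' _ [ [x xs <-] Ax]|m]; last first.
    by rewrite leNgt; apply/negP => cm; apply: nm; exists m.
  split=> //; exists x => // i si; apply: leq_trans (xs i _) _.
    by move: si; rewrite !size_rcons.
  by rewrite !nth_rcons; case: ifP => // _; case: ifP.
have /choice[nxt nxtP] := step.
pose st n := iter n (fun s => rcons s (nxt s)) [::].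
pose k n := nxt (st n).
have stE n : st n = mkseq k n by elim: n => //= n IH; rewrite mkseqS -/(st n) {1}IH.
exists k => n.
have -> : f @` baire_box k n `&` A = S (st n).
  rewrite /S stE size_mkseq; congr (f @` _ `&` A); apply/seteqP.
  by split=> x xk i ni; have := xk i ni; rewrite nth_mkseq.
elim: n => [|n IH]; last exact: nxtP.
rewrite /S /=; have -> // : f @` baire_box (nth 0%N [::]) 0 = range f.
by congr (f @` _); apply/seteqP; split.
Qed.

End BaireCapacity.

(** * Dyadic cubes *)

Section SupNorm.
Context {R : realType} {n : nat}.
Implicit Types u v : 'rV[R]_n.

Lemma coord_le_norm u i : `|u 0 i| <= `|u|.
Proof.
rewrite [leRHS]mx_normrE.
exact: (le_bigmax _ (fun ij : 'I_1 * 'I_n => `|u ij.1 ij.2|) (0, i)).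
Qed.

Lemma norm_le_coord u c : 0 <= c -> (forall i, `|u 0 i| <= c) -> `|u| <= c.
Proof.
move=> c0 uc; rewrite [leLHS]mx_normrE; apply/bigmax_leP; split=> // -[i j] _ /=.
by rewrite ord1.
Qed.

End SupNorm.

Section FloorKeys.
Context {R : realType} {n : nat}.
Implicit Types x y : 'rV[R]_n.

Definition floor_key j x : {ffun 'I_n -> int} :=
  [ffun i => Num.floor (2 ^+ j * x 0 i)].

Lemma floor_key_close j x y :
  floor_key j x = floor_key j y -> `|x - y| <= 2^-1 ^+ j.
Proof.
move=> /ffunP xy; apply: norm_le_coord => [|i].
  by rewrite exprn_ge0// invr_ge0.
rewrite !mxE; have := xy i; rewrite !ffunE => e.
have := floor_itv (2 ^+ j * x 0 i); have := floor_itv (2 ^+ j * y 0 i).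
rewrite e intrD => /andP[y1 y2] /andP[x1 x2].
rewrite exprVn -[leRHS]mulr1 ler_pdivlMl ?exprn_gt0//.
rewrite -[X in X * _](@ger0_norm _ (2 ^+ j)) ?exprn_ge0// -normrM.
rewrite mulrBr ler_norml; apply/andP; split; lra.
Qed.

(** The values 0, 1, 2 of [e] encode the offsets -1, 0, 1, so [e] runs over the [3^n] cubes that
    touch a given one. *)
Definition shift_key (e : {ffun 'I_n -> 'I_3}) (k : {ffun 'I_n -> int}) :
  {ffun 'I_n -> int} := [ffun i => k i + (e i)%:Z - 1].

Lemma shift_key_inj e : injective (shift_key e).
Proof.
move=> k k' /ffunP kk'; apply/ffunP => i.
by have := kk' i; rewrite !ffunE => /addIr/addIr.
Qed.

Lemma close_floor_key j x y : `|x - y| <= 2^-1 ^+ j ->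
  exists e, floor_key j y = shift_key e (floor_key j x).
Proof.
move=> xy.
have h i : exists e : 'I_3, Num.floor (2 ^+ j * y 0 i) =
    Num.floor (2 ^+ j * x 0 i) + e%:Z - 1.
  have {}xy : `|2 ^+ j * x 0 i - 2 ^+ j * y 0 i| <= 1.
    rewrite -mulrBr normrM ger0_norm ?exprn_ge0//.
    rewrite -ler_pdivlMl ?exprn_gt0// mulr1 -exprVn.
    apply: le_trans xy; apply: le_trans (coord_le_norm _ i).
    by rewrite !mxE.
  move: xy; set a := _ * _; set b := _ * _.
  have := floor_itv a; have := floor_itv b.
  set fa := Num.Def.floor a; set fb := Num.Def.floor b.
  move=> /andP[b1 b2] /andP[a1 a2]; rewrite ler_norml => /andP[ab1 ab2].
  have h1 : fa - 1 <= fb.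
    rewrite -ltzD1 -(ltr_int R) intrB; apply: le_lt_trans b2.
    by rewrite (_ : 1%:~R = 1 :> R)//; lra.
  have h2 : fb < fa + 2.
    rewrite -(ltr_int R) (_ : fa + 2 = fa + 1 + 1); last by rewrite -addrA.
    rewrite intrD (_ : 1%:~R = 1 :> R)//; lra.
  have h3 : 0 <= fb - fa + 1 by lia.
  have h4 : (absz (fb - fa + 1)%R < 3)%N by lia.
  exists (Ordinal h4) => /=; lia.
have [e eP] := choice h.
by exists [ffun i => e i]; apply/ffunP => i; rewrite !ffunE eP.
Qed.

End FloorKeys.

Section PairSums.
Context {R : realType} {V : finType} (w : V -> R).
Hypothesis w0 : forall v, 0 <= w v.

Lemma sum_mem_eq (I : eqType) (r : seq I) (a b : I) : uniq r -> a \in r ->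
  \sum_(i <- r) ((a == i)%:R * (b == i)%:R : R) = (a == b)%:R.
Proof.
move=> ur ar; rewrite (bigD1_seq a)//= eqxx mul1r big1 ?addr0 1?eq_sym//.
by move=> i ia; rewrite eq_sym (negPf ia) mul0r.
Qed.

(* Expanding [sum_i (#{a = i} - #{b = i})^2 >= 0] over the masses of the level
   sets of a and b compares the mixed pairs with the diagonal ones. *)
Lemma sum_mixed_pairs_le (I : eqType) (a b : V -> I) :
  (forall v v', (b v == b v') = (a v == a v')) ->
  \sum_v \sum_v' w v * w v' * (a v' == b v)%:R <=
  \sum_v \sum_v' w v * w v' * (a v == a v')%:R.
Proof.
move=> ab.
pose r := undup ([seq a v | v : V] ++ [seq b v | v : V]).
have ur : uniq r by exact: undup_uniq.
have ar v : a v \in r by rewrite mem_undup mem_cat map_f ?mem_enum.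
have br v : b v \in r by rewrite mem_undup mem_cat orbC map_f ?mem_enum.
have sq : 0 <= \sum_(i <- r)
    (\sum_v w v * ((a v == i)%:R - (b v == i)%:R)) ^+ 2.
  by apply: sumr_ge0 => i _; exact: sqr_ge0.
have e : \sum_(i <- r) (\sum_v w v * ((a v == i)%:R - (b v == i)%:R)) ^+ 2 =
    \sum_v \sum_v' w v * w v' *
      ((a v == a v')%:R + (b v == b v')%:R - (a v' == b v)%:R - (a v == b v')%:R).
  under eq_bigr do rewrite expr2 big_distrlr/=.
  rewrite exchange_big/=; apply: eq_bigr => v _.
  rewrite exchange_big/=; apply: eq_bigr => v' _.
  rewrite -(sum_mem_eq (a v') ur (ar v)) -(sum_mem_eq (b v') ur (br v)).
  rewrite -(sum_mem_eq (b v) ur (ar v')) -(sum_mem_eq (b v') ur (ar v)).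
  rewrite -big_split/= -!sumrB mulr_sumr; apply: eq_bigr => i _.
  ring.
move: sq; rewrite e.
under eq_bigr do under eq_bigr do rewrite !mulrBr mulrDr ab.
under eq_bigr do rewrite !sumrB big_split/=.
rewrite !sumrB big_split/=.
have -> : \sum_v \sum_v' w v * w v' * (a v == b v')%:R =
    \sum_v \sum_v' w v * w v' * (a v' == b v)%:R :> R.
  rewrite exchange_big/=; apply: eq_bigr => v _; apply: eq_bigr => v' _.
  by rewrite [w v' * _]mulrC.
lra.
Qed.

(** Close points may lie in different cubes, but only in neighbouring ones. For each of the [3^n]
    offsets the pairs in cubes so related are compared with pairs in the same cube by
    [sum_mixed_pairs_le]. *)
Lemma sum_close_pairs_le (n : nat) (x : V -> 'rV[R]_n) j :
  \sum_v \sum_v' w v * w v' * (`|x v - x v'| <= 2^-1 ^+ j)%R%:R <=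
  (3 ^ n)%:R * \sum_v \sum_v' w v * w v' *
    (floor_key j (x v) == floor_key j (x v'))%:R.
Proof.
apply: (@le_trans _ _ (\sum_(e : {ffun 'I_n -> 'I_3}) \sum_v \sum_v' w v * w v' *
    (floor_key j (x v') == shift_key e (floor_key j (x v)))%:R)).
  rewrite [leRHS]exchange_big/=; apply: ler_sum => v _.
  rewrite [leRHS]exchange_big/=; apply: ler_sum => v' _.
  rewrite -mulr_sumr ler_wpM2l ?mulr_ge0//.
  have [/close_floor_key[e ->]|_] := boolP (`|x v - x v'| <= 2^-1 ^+ j).
    by rewrite (bigD1 e)//= eqxx lerDl sumr_ge0.
  by rewrite sumr_ge0.
apply: (@le_trans _ _ (\sum_(e : {ffun 'I_n -> 'I_3}) \sum_v \sum_v' w v * w v' *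
    (floor_key j (x v) == floor_key j (x v'))%:R)).
  apply: ler_sum => e _; apply: sum_mixed_pairs_le => v v'.
  by rewrite (inj_eq (@shift_key_inj n e)).
by rewrite sumr_const card_ffun !card_ord mulr_natl.
Qed.

End PairSums.

(** * Energies of the projected measures *)

(** The inner sums satisfy [s (k+1) = p * s k + c (k+1)]; summing this recursion gives
    [(1 - p) * T M <= \sum_(l < M) c l]. *)
Lemma sum_convolution_le (R : realType) (p : R) (c : nat -> R) M :
  0 <= p -> p < 1 -> (forall l, 0 <= c l) ->
  \sum_(k < M) \sum_(l < k.+1) p ^+ (k - l) * c l <=
  (1 - p)^-1 * \sum_(l < M) c l.
Proof.
move=> p0 p1 c0.
pose s k := \sum_(l < k.+1) p ^+ (k - l) * c l.
pose T M := \sum_(k < M) s k.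
have s0 k : 0 <= s k by apply: sumr_ge0 => l _; rewrite mulr_ge0// exprn_ge0.
have sS k : s k.+1 = p * s k + c k.+1.
  rewrite /s big_ord_recr/= subnn expr0 mul1r; congr (_ + _).
  rewrite mulr_sumr; apply: eq_bigr => l _.
  by rewrite mulrA -exprS subSn// -ltnS.
have TS N : T N.+1 = p * T N + \sum_(l < N.+1) c l.
  rewrite {1}/T big_ord_recl/= [in RHS]big_ord_recl addrCA; congr (_ + _).
    by rewrite /s big_ord_recl big_ord0 subnn expr0 mul1r addr0.
  rewrite /T mulr_sumr -big_split/=; apply: eq_bigr => k _.
  by rewrite /bump/= add1n sS.
rewrite mulrC ler_pdivlMr ?subr_gt0// -/(T M) mulrBr mulr1 lerBlDl mulrC.
case: M => [|M]; first by rewrite /T !big_ord0 mulr0 add0r.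
rewrite {1}TS lerD2r ler_wpM2l// /T [leRHS]big_ord_recr/= lerDl//.
Qed.

Section TimeEnergy.
Context {R : realType} {n : nat}.
Local Notation mu := (@lebesgue_measure R).
Local Open Scope ereal_scope.

(* [q] is [2^-a], where the sublevel sets of [t |-> N t u / |u|] at height [r]
   have measure O(r^a); heights and norms are only tested at powers of 2. *)
Definition transversal (I : set R) (N : R -> 'rV[R]_n -> R) (q C : R) : Prop :=
  forall (u : 'rV[R]_n) k, exists S : set R,
    [/\ measurable S, forall t, I t -> (N t u <= 2^-1 ^+ k)%R -> S t,
        mu S <= C%:E &
        forall l, (l <= k)%N -> (2^-1 ^+ l <= `|u|)%R ->
          mu S <= (C * q ^+ (k - l))%:E].

Context {I : set R} {N : R -> 'rV[R]_n -> R} {q C b : R}.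
Hypotheses (q0 : (0 < q)%R) (qb : (q < b)%R) (b1 : (b < 1)%R) (C0 : (0 <= C)%R).

Let b0 : (0 < b)%R. Proof. exact: lt_trans qb. Qed.
Let q1 : (q < 1)%R. Proof. exact: lt_trans b1. Qed.
Let bV0 k : (0 <= b^-1 ^+ k)%R.
Proof. by rewrite exprn_ge0// invr_ge0 ltW. Qed.

Lemma measurable_scaled_indic (c : R) (S : set R) :
  measurable S -> measurable_fun setT (fun t => c * \1_S t)%R.
Proof.
by move=> mS; apply: measurable_funM; [exact: measurable_cst|exact: measurable_indic].
Qed.

(** For [2^-(l+1) < |u| <= 2^-l] a single term of the sum suffices, and the factor [1 / q] pays for
    [l + 1] in place of [l]. The term [q^k] covers [|u| > 1]. In this form the bound is linear in
    indicators of closeness, so it can be summed over pairs of atoms. *)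
Lemma transversal_slice_le (u : 'rV[R]_n) k (S : set R) :
  mu S <= C%:E ->
  (forall l, (l <= k)%N -> (2^-1 ^+ l <= `|u|)%R -> mu S <= (C * q ^+ (k - l))%:E) ->
  mu S <= (C / q * (q ^+ k +
    \sum_(l < k.+1) q ^+ (k - l) * (`|u| <= 2^-1 ^+ l)%R%:R))%:E.
Proof.
move=> SC Sl.
have Cq : (C <= C / q)%R by rewrite ler_pdivlMr// ler_piMr// ltW.
have Cq0 : (0 <= C / q)%R by rewrite divr_ge0// ltW.
have s0 l : (0 <= q ^+ (k - l) * (`|u| <= 2^-1 ^+ l)%R%:R)%R.
  by rewrite mulr_ge0// exprn_ge0// ltW.
have qk0 : (0 <= q ^+ k)%R by rewrite exprn_ge0// ltW.
have pick l : (l <= k)%N -> (`|u| <= 2^-1 ^+ l)%R -> mu S <= (C / q * q ^+ (k - l))%:E ->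
    mu S <= (C / q * (q ^+ k +
      \sum_(l < k.+1) q ^+ (k - l) * (`|u| <= 2^-1 ^+ l)%R%:R))%:E.
  move=> lk ul /le_trans; apply; rewrite lee_fin ler_wpM2l//.
  rewrite -ltnS in lk.
  rewrite (bigD1 (Ordinal lk))//= ul mulr1 addrCA lerDl addr_ge0// sumr_ge0//.
have [uk|uk] := boolP (`|u| <= 2^-1 ^+ k)%R.
  by apply: (pick k) => //; rewrite subnn expr0 mulr1 (le_trans SC)// lee_fin.
have ex : exists l, ~~ (`|u| <= 2^-1 ^+ l)%R by exists k.
case: (ex_minnP ex) => -[|l] ul lmin.
  have u1 : (2^-1 ^+ 0 <= `|u|)%R by rewrite ltW// ltNge.
  apply: le_trans (Sl 0%N (leq0n _) u1) _; rewrite subn0 lee_fin.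
  apply: ler_pM => //; first by rewrite lerDl sumr_ge0.
have lk : (l < k)%N by exact: lmin.
apply: (pick l); first exact: ltnW.
  by apply: contraT => /lmin; rewrite ltnn.
apply: le_trans (Sl l.+1 lk _) _; first by rewrite ltW// ltNge.
rewrite lee_fin le_eqVlt; apply/orP; left; apply/eqP.
rewrite (_ : (k - l)%N = (k - l.+1).+1); last by rewrite subnSK.
by rewrite exprS; field; rewrite gt_eqF.
Qed.

(** Each atom is assigned to one set of the cover, and two atoms assigned to [O i] are counted at
    level [k i]. Hence the energy is at least the sum of [b^-(k i) * ms i^2], and Cauchy-Schwarz
    applies to the masses [ms i] of total 1. *)
Lemma time_energy_cover (V : finType) (x : V -> 'rV[R]_n) (w : V -> R) m
    (S : V -> V -> nat -> set R) (t : R) :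
  (forall v, 0 <= w v)%R -> (\sum_v w v = 1)%R ->
  (forall v v' k, (N t (x v - x v') <= 2^-1 ^+ k)%R -> S v v' k t) ->
  forall M (O : nat -> set 'rV[R]_n) (k : nat -> nat),
    (forall i, (i < M)%N -> (k i <= m)%N) ->
    (forall v, exists2 i, (i < M)%N & O i (x v)) ->
    (forall i y z, O i y -> O i z -> (N t (y - z) <= 2^-1 ^+ k i)%R) ->
  (1 <= (\sum_(j < m.+1) \sum_v \sum_v' b^-1 ^+ j * (w v * w v') * \1_(S v v' j) t) *
     \sum_(i < M) b ^+ k i)%R.
Proof.
move=> w0 w1 St M O k km Ox Ok.
have /choice[io ioP] v : exists i : 'I_M, O i (x v).
  by have [i iM Oi] := Ox v; exists (Ordinal iM).
pose ms (i : 'I_M) : R := (\sum_v w v * (io v == i)%:R)%R.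
have ms1 : (\sum_i ms i = 1)%R.
  rewrite /ms exchange_big/= -[RHS]w1; apply: eq_bigr => v _.
  rewrite -mulr_sumr (bigD1 (io v))//= eqxx big1 ?addr0 ?mulr1// => i /negPf.
  by rewrite eq_sym => ->.
pose Q : R := (\sum_(i < M) b^-1 ^+ k i * ms i ^+ 2)%R.
set E := (\sum_(j < m.+1) _)%R; set P := (\sum_(i < M) _)%R.
have QE : (Q <= E)%R.
  apply: (@le_trans _ _ (\sum_v \sum_v' \sum_(j < m.+1)
      b^-1 ^+ j * (w v * w v') * \1_(S v v' j) t)%R); last first.
    rewrite le_eqVlt /E; apply/orP; left; apply/eqP; rewrite [RHS]exchange_big/=.
    by apply: eq_bigr => v _; rewrite [RHS]exchange_big.
  rewrite /Q /ms; under eq_bigr do rewrite expr2 big_distrlr/= mulr_sumr.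
  rewrite exchange_big/=; apply: ler_sum => v _.
  under eq_bigr do rewrite mulr_sumr.
  rewrite exchange_big/=; apply: ler_sum => v' _.
  rewrite (bigD1 (io v))//= eqxx mulr1 big1 ?addr0; last first.
    by move=> i /negPf; rewrite eq_sym => ->; rewrite mulr0 mul0r mulr0.
  have kio : (k (io v) < m.+1)%N by rewrite ltnS km.
  rewrite (bigD1 (Ordinal kio))//=.
  have rest : (0 <= \sum_(i < m.+1 | i != Ordinal kio)
      b^-1 ^+ i * (w v * w v') * \1_(S v v' i) t)%R.
    by apply: sumr_ge0 => j _; rewrite !mulr_ge0.
  apply: ler_wpDr => //; rewrite -mulrA ler_wpM2l// mulrA ler_wpM2l ?mulr_ge0//.
  have [ii|_] := eqVneq (io v') (io v); last by [].
  rewrite indicE mem_set//; apply: St; apply: Ok; first exact: ioP.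
  by rewrite -ii; exact: ioP.
have P0 : (0 <= P)%R by apply: sumr_ge0 => i _; rewrite exprn_ge0// ltW.
(* Cauchy-Schwarz by completing squares: the inequalities [b^-k * (ms * P - b^k)^2 >= 0], summed
   over [i]. *)
have PP : (2 * P <= Q * P ^+ 2 + P)%R.
  have -> : (2 * P = 2 * (P * \sum_i ms i))%R by rewrite ms1 mulr1.
  rewrite 2!mulr_sumr /Q mulr_suml -big_split/=.
  apply: ler_sum => i _.
  have bk0 : (0 < b ^+ k i)%R by rewrite exprn_gt0.
  have : (0 <= b^-1 ^+ k i * (ms i * P - b ^+ k i) ^+ 2)%R by rewrite mulr_ge0 ?sqr_ge0.
  move=> h; rewrite -subr_ge0; apply: le_trans h _.
  rewrite le_eqVlt; apply/orP; left; apply/eqP; rewrite exprVn; field.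
  by rewrite gt_eqF.
have Pgt : (0 < P)%R.
  have [i _] : exists i : 'I_M, True.
    case: (pickP (fun _ : V => true)) => [v _|no]; first by exists (io v).
    have /eqP : (\sum_v w v = 0)%R by rewrite big1// => v _; have := no v.
    by rewrite w1 oner_eq0.
  rewrite /P (bigD1 i)//= ltr_pwDl ?exprn_gt0// sumr_ge0// => j _.
  by rewrite exprn_ge0// ltW.
have : (1 <= Q * P)%R.
  by rewrite -(ler_pM2r Pgt) -mulrA -expr2; lra.
by move=> /le_trans; apply; rewrite ler_wpM2r.
Qed.

(** [E t] is the truncated energy of the projected measure, with sublevel sets replaced by the
    measurable supersets from [transversal], since [N] is not assumed measurable in [t]. Its
    integral is bounded by a convolution of the dyadic energies with powers of [q / b], summable as
    [q < b]. *)
Lemma time_energy (V : finType) (x : V -> 'rV[R]_n) (w : V -> R) m (D : R) :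
  transversal I N q C -> (forall v, 0 <= w v)%R -> (\sum_v w v = 1)%R ->
  (\sum_(j < m.+1) b^-1 ^+ j * (\sum_v \sum_v' w v * w v' *
     (floor_key j (x v) == floor_key j (x v'))%:R) <= D)%R ->
  exists E : R -> R,
    [/\ measurable_fun setT E, forall t, (0 <= E t)%R,
        \int[mu]_t (E t)%:E <= (C / q * ((1 - q / b)^-1 * (1 + (3 ^ n)%:R * D)))%:E &
        forall t, I t -> forall M (O : nat -> set 'rV[R]_n) (k : nat -> nat),
          (forall i, (i < M)%N -> (k i <= m)%N) ->
          (forall v, exists2 i, (i < M)%N & O i (x v)) ->
          (forall i y z, O i y -> O i z -> (N t (y - z) <= 2^-1 ^+ k i)%R) ->
          (1 <= E t * \sum_(i < M) b ^+ k i)%R].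
Proof.
move=> tr w0 w1 wD.
have /choice[S0 S0P] (p : V * V * nat) : exists S : set R,
    [/\ measurable S, forall t, I t -> (N t (x p.1.1 - x p.1.2) <= 2^-1 ^+ p.2)%R -> S t,
        mu S <= C%:E &
        forall l, (l <= p.2)%N -> (2^-1 ^+ l <= `|x p.1.1 - x p.1.2|)%R ->
          mu S <= (C * q ^+ (p.2 - l))%:E] by exact: tr.
pose S v v' k := S0 ((v, v'), k).
have mS v v' k : measurable (S v v' k) by have [] := S0P ((v, v'), k).
exists (fun t => \sum_(j < m.+1) \sum_v \sum_v'
  b^-1 ^+ j * (w v * w v') * \1_(S v v' j) t)%R.
have c0 j v v' : (0 <= b^-1 ^+ j * (w v * w v'))%R by rewrite !mulr_ge0.
split.
- apply: measurable_sum => j; apply: measurable_sum => v.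
  apply: measurable_sum => v'; exact: measurable_scaled_indic.
- by move=> t; do 3!(apply: sumr_ge0 => ? _); rewrite mulr_ge0.
- pose p := (q / b)%R.
  have p0 : (0 <= p)%R by rewrite divr_ge0 ?ltW.
  have p1 : (p < 1)%R by rewrite ltr_pdivrMr// mul1r.
  pose Th l := (\sum_v \sum_v' w v * w v' * (`|x v - x v'| <= 2^-1 ^+ l)%R%:R)%R.
  have Th0 l : (0 <= Th l)%R by do 2!(apply: sumr_ge0 => ? _); rewrite !mulr_ge0.
  apply: (@le_trans _ _ (\sum_(j < m.+1) \sum_v \sum_v'
      (b^-1 ^+ j * (w v * w v'))%:E * mu (S v v' j))).
    under eq_integral do rewrite -sumEFin.
    rewrite ge0_integral_sum//; first last.
    - by move=> j t _; rewrite lee_fin; do 2!(apply: sumr_ge0 => ? _); rewrite mulr_ge0.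
    - move=> j; apply/measurable_EFinP; apply: measurable_sum => v.
      apply: measurable_sum => v'.
      exact: measurable_scaled_indic.
    apply: lee_sum => j _.
    under eq_integral do rewrite -sumEFin.
    rewrite ge0_integral_sum//; first last.
    - by move=> v t _; rewrite lee_fin; apply: sumr_ge0 => ? _; rewrite mulr_ge0.
    - move=> v; apply/measurable_EFinP; apply: measurable_sum => v'.
      exact: measurable_scaled_indic.
    apply: lee_sum => v _.
    under eq_integral do rewrite -sumEFin.
    rewrite ge0_integral_sum//; first last.
    - by move=> v' t _; rewrite lee_fin mulr_ge0.
    - by move=> v'; apply/measurable_EFinP; exact: measurable_scaled_indic.
    apply: lee_sum => v' _.
    under eq_integral do rewrite EFinM.
    rewrite ge0_integralZl_EFin//; last first.
      by apply/measurable_EFinP; apply: measurable_indic; exact: mS.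
    by rewrite integral_indic ?setIT//; exact: mS.
  apply: (@le_trans _ _ (\sum_(j < m.+1) \sum_v \sum_v'
      (b^-1 ^+ j * (w v * w v'))%:E * (C / q * (q ^+ j + \sum_(l < j.+1)
        q ^+ (j - l) * (`|x v - x v'| <= 2^-1 ^+ l)%R%:R))%:E)).
    apply: lee_sum => j _; apply: lee_sum => v _; apply: lee_sum => v' _.
    apply: lee_wpmul2l; first by rewrite lee_fin.
    by have [_ _ SC Sl] := S0P ((v, v'), val j); exact: transversal_slice_le.
  under eq_bigr do under eq_bigr do under eq_bigr do rewrite -EFinM.
  under eq_bigr do under eq_bigr do rewrite sumEFin.
  under eq_bigr do rewrite sumEFin.
  rewrite sumEFin lee_fin.
  have -> : (\sum_(j < m.+1) \sum_v \sum_v' b^-1 ^+ j * (w v * w v') *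
      (C / q * (q ^+ j + \sum_(l < j.+1)
        q ^+ (j - l) * (`|x v - x v'| <= 2^-1 ^+ l)%R%:R)) =
      C / q * (\sum_(j < m.+1) p ^+ j +
        \sum_(j < m.+1) \sum_(l < j.+1) p ^+ (j - l) * (b^-1 ^+ l * Th l)))%R.
    rewrite -big_split/= mulr_sumr; apply: eq_bigr => j _.
    have pE l : (l <= j)%N -> (p ^+ (j - l) * b^-1 ^+ l = b^-1 ^+ j * q ^+ (j - l))%R.
      move=> lj; rewrite /p exprMn -mulrA -exprD subnK// mulrC//.
    have ww : (\sum_v \sum_v' w v * w v' = 1 :> R)%R.
      by rewrite -big_distrlr/= w1 mulr1.
    transitivity (C / q * (\sum_v \sum_v' w v * w v' * (b^-1 ^+ j * q ^+ j) +
        \sum_v \sum_v' \sum_(l < j.+1) b^-1 ^+ j * q ^+ (j - l) *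
          (w v * w v' * (`|x v - x v'| <= 2^-1 ^+ l)%R%:R)))%R.
      rewrite -big_split/= mulr_sumr; apply: eq_bigr => v _.
      rewrite -big_split/= mulr_sumr; apply: eq_bigr => v' _.
      rewrite mulrCA; congr (_ * _)%R; rewrite mulrDr; congr (_ + _)%R; first by ring.
      by rewrite mulr_sumr; apply: eq_bigr => l _; ring.
    congr (_ * (_ + _))%R.
      under eq_bigr do rewrite -mulr_suml.
      by rewrite -mulr_suml ww mul1r -exprMn mulrC.
    transitivity (\sum_v \sum_(l < j.+1) \sum_v' b^-1 ^+ j * q ^+ (j - l) *
        (w v * w v' * (`|x v - x v'| <= 2^-1 ^+ l)%R%:R))%R.
      by apply: eq_bigr => v _; rewrite exchange_big.
    rewrite exchange_big/=; apply: eq_bigr => l _.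
    rewrite mulrA pE; last by rewrite -ltnS.
    by rewrite /Th mulr_sumr; apply: eq_bigr => v _; rewrite mulr_sumr.
  rewrite ler_wpM2l//; first by rewrite divr_ge0// ltW.
  rewrite mulrDr mulr1 lerD ?sum_expr_le//.
  apply: le_trans (@sum_convolution_le R p (fun l => b^-1 ^+ l * Th l)%R m.+1 p0 p1 _) _.
    by move=> l; rewrite mulr_ge0.
  rewrite ler_wpM2l ?invr_ge0 ?subr_ge0 ?(ltW p1)//.
  apply: le_trans (ler_wpM2l _ wD); last by [].
  rewrite mulr_sumr; apply: ler_sum => l _.
  by rewrite mulrCA ler_wpM2l//; exact: sum_close_pairs_le.
- move=> t It M O k; apply: time_energy_cover => // v v' j.
  by have [_ + _ _] := S0P (v, v', j); exact.
Qed.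

End TimeEnergy.

Section LiminfFinite.
Context {R : realType}.
Local Notation mu := (@lebesgue_measure R).
Local Open Scope ereal_scope.

(** By Fatou the lower limit is integrable, hence finite almost everywhere, and its value plus 1 is
    an upper bound infinitely often. The good indices depend on [t]. *)
Lemma ae_bounded_infinitely_often (E : nat -> R -> R) (C : R) :
  (forall m, measurable_fun setT (E m)) -> (forall m t, (0 <= E m t)%R) ->
  (forall m, \int[mu]_t (E m t)%:E <= C%:E) ->
  {ae mu, forall t, exists M : R, forall n, exists2 m, (n <= m)%N & (E m t <= M)%R}.
Proof.
move=> mE E0 EC.
pose f m t := (E m t)%:E.
have mf m : measurable_fun setT (f m) by apply/measurable_EFinP.
have f0 m t : 0 <= f m t by rewrite lee_fin.
pose g t := limn_einf (f ^~ t).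
have gsup t : g t = ereal_sup (range (einfs (f ^~ t))).
  by rewrite /g limn_einf_lim; apply/cvg_lim => //; exact: cvg_einfs_sup.
have einfs_le (u : (\bar R)^nat) n : einfs u n <= u n.
  by apply: ereal_inf_lbound; exists n => /=.
have g0 t : 0 <= g t.
  rewrite gsup; apply: (@le_trans _ _ (einfs (f ^~ t) 0%N)).
    by apply/ereal_infP => _ [m _ <-].
  by apply: ereal_sup_ubound; exists 0%N.
have mg : measurable_fun setT g.
  rewrite /g /limn_einf; apply: measurableT_comp => //.
  by apply: measurable_fun_limn_esup => m; exact: measurableT_comp.
have gC : \int[mu]_t g t <= C%:E.
  apply: le_trans (fatou mu measurableT mf _) _; first by [].
  rewrite limn_einf_lim; apply: lime_le; first exact: is_cvg_einfs.
  apply: nearW => n /=; exact: (le_trans (einfs_le (fun m => \int[mu]_t f m t) n) (EC n)).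
have ig : mu.-integrable setT g.
  apply/integrableP; split => //.
  under eq_integral do rewrite gee0_abs//.
  by rewrite (le_lt_trans gC)// ltry.
apply: filterS (integrable_ae measurableT ig) => t /(_ I) gt.
exists (fine (g t) + 1)%R => n; apply: contrapT => nm.
have : (fine (g t) + 1)%:E <= g t.
  rewrite {2}gsup; apply: (@le_trans _ _ (einfs (f ^~ t) n)).
    apply/ereal_infP => _ [m /= nlem <-]; rewrite lee_fin leNgt; apply/negP => h.
    by apply: nm; exists m => //; exact: ltW.
  by apply: ereal_sup_ubound; exists n.
by rewrite -[X in _ <= X](fineK gt) lee_fin gerDl ler10.
Qed.

End LiminfFinite.

(** * Absence of cheap covers for almost every parameter *)

Section AlmostEveryTime.
Context {R : realType} {n : nat}.
Local Notation mu := (@lebesgue_measure R).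

(** Nullity of the projection at exponent [s] when [b = 2^-s], expressed by open sets upstairs with
    dyadic sizes, so that compactness can be used before projecting. *)
Definition thin (b : R) (d : 'rV[R]_n -> R) (A : set 'rV[R]_n) : Prop :=
  forall e : R, 0 < e -> exists (O : nat -> set 'rV[R]_n) (k : nat -> nat),
    [/\ forall i, open (O i), A `<=` \bigcup_i O i,
        forall i x y, O i x -> O i y -> d (x - y) <= 2^-1 ^+ k i &
        forall M, \sum_(i < M) b ^+ k i <= e].

Lemma floor_key_finite (N m : nat) : exists (Phi : finType) (key : 'rV[R]_n -> Phi),
  forall x y, `|x| <= N%:R -> `|y| <= N%:R -> key x = key y ->
  forall j, (j <= m)%N -> floor_key j x = floor_key j y.
Proof.
pose K := (2 * (2 ^ m * N))%N.
(* The offset makes all occurring cube indices nonnegative and at most [K]. *)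
pose code (z : int) : 'I_K.+1 := inord (absz (z + (2 ^ m * N)%:Z)).
pose Phi : finType := {ffun 'I_m.+1 -> {ffun 'I_n -> 'I_K.+1}}.
exists Phi, (fun x => [ffun j : 'I_m.+1 => [ffun i => code (floor_key j x i)]]).
have codeP (j : nat) (x : 'rV[R]_n) i : (j <= m)%N -> `|x| <= N%:R ->
    (code (floor_key j x i) : nat)%:Z = floor_key j x i + (2 ^ m * N)%:Z.
  move=> jm xN; rewrite ffunE.
  have xi : `|2 ^+ j * x 0 i| <= (2 ^ m * N)%:R.
    rewrite normrM natrM ger0_norm ?exprn_ge0//; apply: ler_pM => //.
      by rewrite natrX ler_weXn2l// ler1n.
    exact: le_trans (coord_le_norm x i) xN.
  move: xi; set a := _ * x 0 i; rewrite ler_norml => /andP[a1 a2].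
  have := floor_itv a; rewrite intrD => /andP[b1 b2].
  have f1 : - (2 ^ m * N)%:Z <= Num.floor a.
    rewrite -ltzD1 -(ltr_int R) intrD mulrNz; apply: le_lt_trans b2.
    exact: a1.
  have f2 : Num.floor a <= (2 ^ m * N)%:Z.
    by rewrite -(ler_int R); apply: le_trans b1 _.
  by rewrite /code inordK /K; lia.
move=> x y xN yN /ffunP xy j jm; apply/ffunP => i.
have jm' : (j < m.+1)%N by [].
have e : code (floor_key j x i) = code (floor_key j y i).
  by have := xy (Ordinal jm'); rewrite [LHS]ffunE [RHS]ffunE => /ffunP/(_ i);
    rewrite [LHS]ffunE [RHS]ffunE.
apply: (@addIr _ (2 ^ m * N)%:Z).
by rewrite -!codeP// e.
Qed.

(** The exceptional null set comes from the energies alone, before any cover is given. A cover,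
    which may depend on [t], is met afterwards by choosing one large [m]. *)
Lemma ae_not_thin (f : baire_space -> 'rV[R]_n) (I : set R)
    (N : R -> 'rV[R]_n -> R) (q C b c : R) :
  continuous f -> 0 < q -> q < b -> b < 1 -> 0 <= C -> transversal I N q C ->
  0 < c -> (c%:E < capacity (level_kernel floor_key b) (range f))%E ->
  {ae mu, forall t, I t -> ~ thin b (N t) (range f)}.
Proof.
move=> cf q0 qb b1 C0 tr c0 cap.
have b0 : 0 < b by exact: lt_trans qb.
have K0 (x : 'rV[R]_n) p : 0 <= level_kernel floor_key b x p.
  exact: level_kernel_ge0.
(* A bounded part of [range f] keeps capacity above [c], again by continuity along increasing
   unions; boundedness is what makes the set of keys finite. *)
have [B capB] : exists B : nat,
    (c%:E < capacity (level_kernel floor_key b)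
       (range f `&` [set x | (`|x| <= B%:R)%R]))%E.
  apply: contrapT => nB; move: cap; apply/negP; rewrite -leNgt.
  have -> : range f = \bigcup_B (range f `&` [set x | (`|x| <= B%:R)%R]).
    rewrite -setI_bigcupr; apply/seteqP; split=> [x fx|x []//]; split=> //.
    exists (Num.bound `|x|) => //=; apply/ltW.
    exact: archi_boundP.
  apply: capacity_bigcup => // [i j ij x [fx xi]|i].
    by split=> //=; apply: le_trans xi _; rewrite ler_nat.
  by rewrite leNgt; apply/negP => ci; apply: nB; exists i.
have [k capk] := capacity_baire_box K0 capB.
pose F : R := C / q * ((1 - q / b)^-1 * (1 + (3 ^ n)%:R * (4 / c))).
have /choice[E EP] m : exists E : R -> R,
    [/\ measurable_fun setT E, forall t, 0 <= E t,
        (\int[mu]_t (E t)%:E <= F%:E)%E &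
        forall t, I t -> forall M (O : nat -> set 'rV[R]_n) (l : nat -> nat),
          (forall i, (i < M)%N -> (l i <= m)%N) ->
          f @` baire_box k m `<=` \bigcup_(i < M) O i ->
          (forall i y z, O i y -> O i z -> N t (y - z) <= 2^-1 ^+ l i) ->
          1 <= E t * \sum_(i < M) b ^+ l i].
  have [Phi [key keyP]] := floor_key_finite B m.
  have [r [w [rA w0 w1 wE]]] : exists (r : Phi -> 'rV[R]_n) (w : Phi -> R),
    [/\ forall v, (f @` baire_box k m `&` [set x | (`|x| <= B%:R)%R]) (r v),
      forall v, 0 <= w v, \sum_v w v = 1 &
      \sum_(j < m.+1) b^-1 ^+ j *
        (\sum_v \sum_v' w v * w v' *
           (floor_key j (r v) == floor_key j (r v'))%:R) <= 4 / c].
    apply: (capacity_gt_measure (key := key) b0 c0 (capk m)).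
    by move=> x y [_ xB] [_ yB]; exact: keyP.
  have [E [mE E0 EF EP]] := time_energy q0 qb b1 C0 tr w0 w1 wE.
  exists E; split=> [//|//|//|t It M O l lm fO Ol].
  apply: (EP t It M O l lm _ Ol) => v.
  by have [fv _] := rA v; have [i /= iM Oi] := fO _ fv; exists i.
have aeE : {ae mu, forall t, exists M : R, forall n, exists2 m, (n <= m)%N & E m t <= M}.
  by apply: (@ae_bounded_infinitely_often R E F) => m; have [] := EP m.
apply: (@filterS _ _ (ae_filter_ringOfSetsType _) _ _ _ aeE) => t [M ME] It thint.
have M0 : 0 <= M.
  have [m _ mM] := ME 0%N; apply: le_trans mM.
  by have [_ + _ _] := EP m; exact.
have e0 : 0 < (2 * (M + 1))^-1 by rewrite invr_gt0; lra.
have [W [l [oW fW Wl lM]]] := thint _ e0.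
have [n0 fn0] := baire_box_cover k cf oW fW.
(* The sum exceeds both requirements on [m]: at least [n0], so that the box of depth [m] is covered,
   and at least each level [l i] in use. *)
have [m nm mM] := ME (n0 + \sum_(i < n0) l i)%N.
have [_ Em0 _ Em] := EP m.
have : 1 <= E m t * \sum_(i < n0) b ^+ l i.
  apply: (Em t It n0 W l).
  - move=> i iM; apply: leq_trans nm; apply: leq_trans (leq_addl _ _).
    by rewrite (bigD1 (Ordinal iM))//= leq_addr.
  - apply: subset_trans fn0 => _ [x xm <-]; exists x => // i iM; apply: xm.
    by apply: leq_trans iM _; apply: leq_trans nm; exact: leq_addr.
  - exact: Wl.
apply/negP; rewrite -ltNge.
apply: (@le_lt_trans _ _ (M * (2 * (M + 1))^-1)).
  apply: ler_pM => //; first by apply: sumr_ge0 => i _; rewrite exprn_ge0// ltW.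
by rewrite ltr_pdivrMr; lra.
Qed.

End AlmostEveryTime.

(** * Sublevel sets along the curve *)

Section DotProduct.
Context {R : realType} {n : nat}.
Implicit Types u v w : 'rV[R]_n.

Lemma dotC u v : dot u v = dot v u.
Proof. by apply: eq_bigr => i _; rewrite mulrC. Qed.

Lemma dotDl u v w : dot (u + v) w = dot u w + dot v w.
Proof. by rewrite -big_split; apply: eq_bigr => i _; rewrite mxE mulrDl. Qed.

Lemma dotZl a u v : dot (a *: u) v = a * dot u v.
Proof. by rewrite [RHS]big_distrr; apply: eq_bigr => i _; rewrite mxE -mulrA. Qed.

Lemma dotBl u v w : dot (u - v) w = dot u w - dot v w.
Proof. by rewrite dotDl -scaleN1r dotZl mulN1r. Qed.

Lemma dotBr u v w : dot u (v - w) = dot u v - dot u w.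
Proof. by rewrite dotC dotBl ![dot _ u]dotC. Qed.

Lemma dotZr a u v : dot u (a *: v) = a * dot u v.
Proof. by rewrite dotC dotZl dotC. Qed.

Lemma dot0l u : dot 0 u = 0.
Proof. by rewrite -(scale0r 0) dotZl mul0r. Qed.

Lemma dot_ge0 u : 0 <= dot u u.
Proof. by apply: sumr_ge0 => i _; rewrite -expr2 sqr_ge0. Qed.

Lemma dot_le_norm u v : `|dot u v| <= n%:R * (`|u| * `|v|).
Proof.
apply: le_trans (ler_norm_sum _ _ _) _.
rewrite (_ : n%:R * (`|u| * `|v|) = \sum_(i < n) `|u| * `|v|); last first.
  by rewrite sumr_const card_ord mulr_natl.
apply: ler_sum => i _; rewrite normrM; apply: ler_pM => //; exact: coord_le_norm.
Qed.

Lemma sqr_norm_le_dot u : `|u| ^+ 2 <= dot u u.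
Proof.
rewrite -[leRHS]sqr_sqrtr ?dot_ge0// ler_sqr ?nnegrE ?sqrtr_ge0//.
apply: norm_le_coord => [|i]; first exact: sqrtr_ge0.
rewrite -sqrtr_sqr ler_wsqrtr// /dot (bigD1 i)//= -expr2 lerDl.
by apply: sumr_ge0 => j _; rewrite -expr2 sqr_ge0.
Qed.

Lemma norm_le_enorm u : `|u| <= enorm u.
Proof.
by rewrite -[leLHS]ger0_norm// -sqrtr_sqr ler_wsqrtr// sqr_norm_le_dot.
Qed.

Lemma enorm_le_norm u : enorm u <= n%:R * `|u|.
Proof.
rewrite /enorm -[leRHS]ger0_norm ?mulr_ge0// -sqrtr_sqr ler_wsqrtr//.
apply: le_trans (ler_norm _) _; apply: le_trans (dot_le_norm u u) _.
rewrite -expr2 exprMn ler_wpM2r ?sqr_ge0//.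
by rewrite expr2 -natrM ler_nat; case: (n) => // m; rewrite leq_pmulr.
Qed.

Lemma dot_continuous v : continuous (fun u => dot u v).
Proof.
rewrite /dot; elim: (index_enum _) => [|i r IH].
  rewrite (_ : (fun _ => _) = cst 0); first by move=> x; exact: cst_continuous.
  by apply/funext => u; rewrite big_nil.
rewrite (_ : (fun _ => _) = (fun u => u 0 i * v 0 i) \+
    (fun u => \sum_(j <- r) u 0 j * v 0 j)); last first.
  by apply/funext => u; rewrite big_cons.
move=> x; apply: continuousD; last exact: IH.
apply: continuousM; first exact: coord_continuous.
exact: cst_continuous.
Qed.

Lemma is_derive_dot (g : R -> 'rV[R]_n) (t : R) v :
  derivable g t 1 -> is_derive t 1 (fun s => dot (g s) v) (dot (derive1 g t) v).
Proof.
move=> dg.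
have h : (fun h => h^-1 *: (((fun s => dot (g s) v) \o shift t) (h *: 1) -
    dot (g t) v)) @ 0^' --> dot (derive1 g t) v.
  rewrite derive1E.
  have := cvg_comp _ _ dg (@dot_continuous v ('D_1 g t)).
  apply: cvg_trans; apply: near_eq_cvg; apply: nearW => h /=.
  by rewrite dotZl dotBl.
apply: DeriveDef; first by apply/cvg_ex; eexists; exact: h.
exact/cvg_lim.
Qed.

End DotProduct.

Section Sublevels.
Context {R : realType}.
Local Notation mu := (@lebesgue_measure R).

(** An interval centred at any point of [A] works; the factor 2 is the cost of not locating the
    endpoints. *)
Lemma small_set_cover (A : set R) (L : R) : 0 <= L ->
  (forall x y, A x -> A y -> x <= y -> y - x <= L) ->
  exists S : set R, [/\ measurable S, A `<=` S & (mu S <= (2 * L)%:E)%E].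
Proof.
move=> L0 AL; have [->|/set0P[a Aa]] := eqVneq A set0.
  exists set0; split=> //.
  by rewrite measure0 lee_fin mulr_ge0.
exists `[a - L, a + L]%classic; split => [|x Ax|].
- exact: measurable_itv.
- rewrite /= in_itv/=; have [xa|xa] := leP x a.
    by have := AL _ _ Ax Aa xa; lra.
  by have := AL _ _ Aa Ax (ltW xa); lra.
- rewrite lebesgue_measure_itv/=; case: ifP => _; last by rewrite lee_fin mulr_ge0.
  by rewrite -EFinB lee_fin; lra.
Qed.

Lemma MVT_in (I : set R) (g dg : R -> R) x y : is_interval I ->
  (forall t, I t -> is_derive t 1 g (dg t)) -> I x -> I y -> x <= y ->
  exists c, [/\ x <= c, c <= y, I c & g y - g x = dg c * (y - x)].
Proof.
move=> itvI dI Ix Iy xy.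
have Ic c : x <= c -> c <= y -> I c by move=> xc cy; apply: (itvI x y) => //; rewrite xc.
have [c + e] : exists2 c, c \in `[x, y]%R & g y - g x = dg c * (y - x).
  apply: MVT_segment => // [c|].
    by rewrite in_itv/= => /andP[/ltW xc /ltW cy]; exact/dI/Ic.
  apply: derivable_within_continuous => c; rewrite in_itv/= => /andP[xc cy].
  by have [] := dI c (Ic c xc cy).
by rewrite in_itv/= => /andP[xc cy]; exists c; split=> //; exact: Ic.
Qed.

Lemma sublevel_derive1 (I : set R) (g dg : R -> R) (m d : R) : is_interval I ->
  (forall t, I t -> is_derive t 1 g (dg t)) -> 0 < m -> 0 <= d ->
  (forall t, I t -> m <= `|dg t|) ->
  exists S : set R, [/\ measurable S,
    forall t, I t -> `|g t| <= d -> S t & (mu S <= (4 * (d / m))%:E)%E].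
Proof.
move=> itvI dI m0 d0 mI.
have [||S [mS AS SL]] := @small_set_cover [set t | I t /\ `|g t| <= d] (2 * (d / m)).
- by rewrite mulr_ge0// divr_ge0// ltW.
- move=> x y [Ix gx] [Iy gy] xy.
  have [c [_ _ Ic e]] := MVT_in itvI dI Ix Iy xy.
  rewrite mulrA ler_pdivlMr//.
  have : `|g y - g x| <= 2 * d by apply: le_trans (ler_normB _ _) _; lra.
  rewrite e normrM [`|y - x|]ger0_norm ?subr_ge0//; apply: le_trans.
  by rewrite mulrC ler_wpM2r ?subr_ge0// mI.
exists S; split => // [t It gt|]; first exact: AS.
by apply: le_trans SL _; rewrite lee_fin; lra.
Qed.

(* The sublevel set of g is split according to the size of g': where |g'| <= h
   use g'' >= m, where |g'| > h use the bound on g'. *)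
Lemma sublevel_derive2 (I : set R) (g g1 g2 : R -> R) (m d h : R) : is_interval I ->
  (forall t, I t -> is_derive t 1 g (g1 t)) ->
  (forall t, I t -> is_derive t 1 g1 (g2 t)) ->
  0 < m -> 0 <= d -> 0 < h -> (forall t, I t -> m <= g2 t) ->
  exists S : set R, [/\ measurable S,
    forall t, I t -> `|g t| <= d -> S t & (mu S <= (4 * (h / m) + 8 * (d / h))%:E)%E].
Proof.
move=> itvI dI dI1 m0 d0 h0 mI.
have g1_mono x y : I x -> I y -> x <= y -> g1 x <= g1 y.
  move=> Ix Iy xy; have [c [_ _ Ic e]] := MVT_in itvI dI1 Ix Iy xy.
  rewrite -subr_ge0 e mulr_ge0 ?subr_ge0//.
  by apply: le_trans (mI c Ic); exact: ltW.
have [S1 [mS1 S1P S1m]] : exists S : set R, [/\ measurable S,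
    forall t, I t -> `|g1 t| <= h -> S t & (mu S <= (4 * (h / m))%:E)%E].
  apply: (sublevel_derive1 itvI dI1) => //; first exact: ltW.
  by move=> t It; apply: le_trans (mI t It) (ler_norm _).
(* The sets treated here need not be intervals; it is enough that [|g1| >= h] between any two of
   their points, which the monotonicity of [g1] provides for [h < g1] and for [g1 < - h]. *)
have step (P : R -> Prop) : (forall x y c, I x -> I y -> I c -> x <= c -> c <= y ->
      P x -> P y -> h <= `|g1 c|) ->
    exists S : set R, [/\ measurable S,
      [set t | [/\ I t, `|g t| <= d & P t]] `<=` S & (mu S <= (4 * (d / h))%:E)%E].
  move=> hP.
  have [||S [mS AS SL]] := @small_set_cover
    [set t | [/\ I t, `|g t| <= d & P t]] (2 * (d / h)).
  - by rewrite mulr_ge0// divr_ge0// ltW.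
  - move=> x y [Ix gx Px] [Iy gy Py] xy.
    have [c [xc cy Ic e]] := MVT_in itvI dI Ix Iy xy.
    rewrite mulrA ler_pdivlMr//.
    have : `|g y - g x| <= 2 * d by apply: le_trans (ler_normB _ _) _; lra.
    rewrite e normrM [`|y - x|]ger0_norm ?subr_ge0//; apply: le_trans.
    rewrite mulrC ler_wpM2r ?subr_ge0//; exact: (hP x y).
  by exists S; split => //; apply: le_trans SL _; rewrite lee_fin; lra.
have [S2 [mS2 S2P S2m]] := step (fun t => h < g1 t)
  (fun x y c Ix Iy Ic xc cy hx hy =>
     le_trans (le_trans (ltW hx) (g1_mono _ _ Ix Ic xc)) (ler_norm _)).
have [S3 [mS3 S3P S3m]] : exists S : set R, [/\ measurable S,
    [set t | [/\ I t, `|g t| <= d & g1 t < - h]] `<=` S & (mu S <= (4 * (d / h))%:E)%E].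
  apply: (step (fun t => g1 t < - h)) => x y c Ix Iy Ic xc cy hx hy.
  rewrite -normrN; apply: le_trans (ler_norm _).
  by rewrite lerNr (le_trans (g1_mono _ _ Ic Iy cy))// ltW.
exists (S1 `|` S2 `|` S3); split.
- by apply: measurableU => //; exact: measurableU.
- move=> t It gt; have [h1|h1] := leP `|g1 t| h; first by left; left; exact: S1P.
  move: h1; rewrite lter_normr => /orP[h1|h1].
    by left; right; apply: S2P.
  by right; apply: S3P; split=> //; rewrite ltrNr.
- apply: le_trans (measureU2 _ _ _) _ => //; first exact: measurableU.
  have e : (4 * (h / m) + 8 * (d / h) = 4 * (h / m) + 4 * (d / h) + 4 * (d / h)) by lra.
  rewrite e EFinD leeD//; apply: le_trans (measureU2 _ _ _) _ => //.
  by rewrite EFinD leeD.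
Qed.

End Sublevels.

(** * Transversality of the projections to lines and to planes *)

Section CurveTransversality.
Context {R : realType}.
Local Notation mu := (@lebesgue_measure R).

(** Each coordinate of [e] is a combination of the products [dot v e], with coefficients of total
    size at most [A]. If all products were below [|e| / (A + 1)], every coordinate would be at most
    [|e| * A / (A + 1)]. *)
Lemma spanning_bound (n : nat) (X : seq 'rV[R]_n) : X != [::] ->
  (<<X>> = fullv)%VS ->
  exists2 c : R, 0 < c & forall e, exists2 v, v \in X & c * `|e| <= `|dot v e|.
Proof.
move=> X0 spanX.
pose a (i : 'I_(size X)) (j : 'I_n) := coord (in_tuple X) i (delta_mx 0 j : 'rV[R]_n).
pose A := \sum_j \sum_i `|a i j|.
have A0 : 0 <= A by apply: sumr_ge0 => j _; exact: sumr_ge0.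
exists (A + 1)^-1; first by rewrite invr_gt0; lra.
move=> e; apply: contrapT => none.
have {}none v : v \in X -> `|dot v e| < (A + 1)^-1 * `|e|.
  by move=> vX; rewrite ltNge; apply/negP => h; apply: none; exists v.
have e0 : 0 < `|e|.
  have [v vX] : exists v, v \in X by case: (X) X0 => // v s _; exists v; rewrite mem_head.
  have := le_lt_trans (normr_ge0 _) (none _ vX).
  by rewrite pmulr_rgt0// invr_gt0; lra.
have : `|e| <= A * ((A + 1)^-1 * `|e|).
  apply: norm_le_coord => [|j].
    by rewrite !mulr_ge0// invr_ge0; lra.
  have -> : e 0 j = \sum_i a i j * dot X`_i e.
    have -> : e 0 j = dot (delta_mx 0 j) e.
      rewrite /dot (bigD1 j)//= mxE !eqxx mul1r big1 ?addr0// => i /negPf ij.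
      by rewrite mxE ij andbF mul0r.
    have : delta_mx 0 j \in <<in_tuple X>>%VS by rewrite spanX memvf.
    move=> /coord_span {1}->.
    rewrite (big_morph (fun u => dot u e) (fun u v => dotDl u v e) (dot0l e)).
    by apply: eq_bigr => i _; rewrite dotZl.
  apply: le_trans (ler_norm_sum _ _ _) _.
  apply: (@le_trans _ _ (\sum_i `|a i j| * ((A + 1)^-1 * `|e|))).
    apply: ler_sum => i _; rewrite normrM ler_wpM2l// ltW// none// mem_nth//.
  rewrite -mulr_suml ler_wpM2r//; first by rewrite mulr_ge0// invr_ge0; lra.
  rewrite /A (bigD1 j)//= lerDl; apply: sumr_ge0 => k _; exact: sumr_ge0.
rewrite mulrA -[X in X <= _]mul1r ler_pM2r// ler_pdivlMr; last by lra.
lra.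
Qed.

(** If [d = 2^-k] and [|u| >= 2^-l] then [d / |u| <= 2^-(k-l)]. Intersecting with [J] gives the
    bound that is independent of [|u|], the only one asked when [u = 0]. *)
Lemma transversal_of_rate n (I : set R) (N : R -> 'rV[R]_n -> R) (phi : R -> R)
    (q C : R) (J : set R) :
  (forall x y, 0 <= x -> x <= y -> phi x <= phi y) ->
  (forall j, phi (2^-1 ^+ j) = q ^+ j) -> 0 <= C ->
  measurable J -> I `<=` J -> (mu J <= C%:E)%E ->
  (forall u d, u != 0 -> 0 < d -> exists S : set R,
    [/\ measurable S, forall t, I t -> N t u <= d -> S t &
        (mu S <= (C * phi (d / `|u|))%:E)%E]) ->
  transversal I N q C.
Proof.
move=> phi_mono phiE C0 mJ IJ JC h u k.
have [->|u0] := eqVneq u 0.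
  exists J; split => // [t It _|l lk]; first exact: IJ.
  by rewrite normr0 leNgt exprn_gt0// invr_gt0.
have k0 : 0 < 2^-1 ^+ k :> R by rewrite exprn_gt0// invr_gt0.
have [S [mS SP SC]] := h u _ u0 k0.
have mSJ : measurable (S `&` J) by exact: measurableI.
exists (S `&` J); split => //.
- by move=> t It Nt; split; [exact: SP|exact: IJ].
- by apply: le_trans JC; apply: le_measure; rewrite ?inE//; exact: subIsetr.
- move=> l lk ul.
  apply: (@le_trans _ _ (mu S)).
    by apply: le_measure; rewrite ?inE//; exact: subIsetl.
  apply: le_trans SC _; rewrite lee_fin ler_wpM2l// -phiE.
  have un0 : 0 < `|u| by rewrite normr_gt0.
  apply: phi_mono; first by rewrite divr_ge0// ltW.
  rewrite ler_pdivrMr// -{1}(subnK lk) exprD ler_wpM2l//.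
Qed.

(* [G k] stands for the k-th derivative of the curve; keeping it abstract
   prevents conversion from unfolding the limits that define derivatives. *)
Variables (U : set R) (G : nat -> R -> 'rV[R]_3).
Hypotheses (oU : open U)
  (G_continuous : forall k t, (k < 3)%N -> U t -> {for t, continuous (G k)})
  (G_derive : forall k t v, (k < 2)%N -> U t ->
    is_derive t 1 (fun s => dot (G k s) v) (dot (G k.+1 t) v))
  (G_unit : forall t, U t -> enorm (G 0 t) = 1)
  (G_span : forall t, U t -> (<<[:: G 0 t; G 1 t; G 2 t]>> = fullv)%VS).

Let G0_le1 t : U t -> `|G 0 t| <= 1.
Proof. by move=> Ut; rewrite -(G_unit Ut) norm_le_enorm. Qed.

Lemma curve_nearby t0 (h : R) : U t0 -> 0 < h -> exists r : R,
  [/\ 0 < r, r <= 1, ball t0 r `<=` U &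
    forall k t, (k < 3)%N -> ball t0 r t -> `|G k t - G k t0| <= h].
Proof.
move=> Ut0 h0.
have near_k k : (k < 3)%N -> \forall t \near t0, `|G k t - G k t0| <= h.
  move=> k3; have /cvgrPdist_le/(_ h h0) := G_continuous k3 Ut0.
  by apply: filterS => t; rewrite distrC.
have : \forall t \near t0, [/\ U t, `|G 0 t - G 0 t0| <= h,
    `|G 1 t - G 1 t0| <= h & `|G 2 t - G 2 t0| <= h].
  have nU : nbhs t0 U by apply: open_nbhs_nbhs; split.
  have n0 : \forall t \near t0, `|G 0 t - G 0 t0| <= h by exact: near_k.
  have n1 : \forall t \near t0, `|G 1 t - G 1 t0| <= h by exact: near_k.
  have n2 : \forall t \near t0, `|G 2 t - G 2 t0| <= h by exact: near_k.
  by apply: filterS (filterI (filterI nU n0) (filterI n1 n2)) => t [[? ?] [? ?]].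
move=> /nbhs_ballP[r /= r0 rP].
have sub : ball t0 (Num.min r 1) `<=` ball t0 r.
  by apply: le_ball; rewrite ge_min lexx.
exists (Num.min r 1); split.
- by rewrite lt_min r0 ltr01.
- by rewrite ge_min lexx orbT.
- by move=> t /sub /rP[].
- move=> k t k3 /sub /rP[_ h0' h1' h2'].
  case: k k3 => [|[|[|k]]] k3.
  + exact h0'.
  + exact h1'.
  + exact h2'.
  + discriminate k3.
Qed.

Let ball_itv (t r : R) : is_interval (ball t r).
Proof. by rewrite ball_itv; exact: interval_is_interval. Qed.

Let mu_ball (t r : R) : 0 < r -> r <= 1 -> (mu (ball t r) <= 2%:E)%E.
Proof.
move=> r0 r1; rewrite lebesgue_measure_ball ?(ltW r0)// lee_fin.
by rewrite -mulr_natr; lra.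
Qed.

(** At [t0] one of the products of [e] with the curve and its first two derivatives is at least
    [c * |e|], and half of this persists nearby. The three cases give an empty set, a bound of order
    [x = d / |e|], and one of order [sqrt x]. *)
Lemma line_transversal t0 : U t0 -> exists (r C : R),
  [/\ 0 < r, 0 <= C, ball t0 r `<=` U &
    transversal (ball t0 r) (fun t u => `|dot (G 0 t) u|) (Num.sqrt 2^-1) C].
Proof.
move=> Ut0.
have [c c0 cP] : exists2 c : R, 0 < c & forall e, exists2 k, (k < 3)%N &
    c * `|e| <= `|dot (G k t0) e|.
  have [|c c0 cP] := spanning_bound _ (G_span Ut0); first by [].
  exists c => // e; have [v] := cP e; rewrite !inE => /or3P[]/eqP-> h.
  - by exists 0%N.
  - by exists 1%N.
  - by exists 2%N.
(* The factor 3 of [dot_le_norm] turns [c / 6] into the permitted change [c / 2]. *)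
have c60 : 0 < c / 6 by rewrite divr_gt0.
have [r [r0 r1 rU rG]] := curve_nearby Ut0 c60.
(* For [x >= ka] the whole ball is taken. Below, [x < 1] gives [x <= sqrt x], and [x < c / 2] gives
   [d < m], which empties the case [k = 0]. *)
pose ka := Num.min 1 (c / 2).
have ka0 : 0 < ka by rewrite lt_min ltr01 divr_gt0.
pose c' := Num.sqrt (c / 2).
have c'0 : 0 < c' by rewrite sqrtr_gt0 divr_gt0.
have c'2 : c' ^+ 2 = c / 2 by rewrite sqr_sqrtr// divr_ge0// ltW.
pose C1 := 2 / Num.sqrt ka; pose C2 := 8 / c; pose C3 := 12 / c'.
have C10 : 0 < C1 by rewrite divr_gt0// sqrtr_gt0.
have C20 : 0 < C2 by rewrite divr_gt0.
have C30 : 0 < C3 by rewrite divr_gt0.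
exists r, (C1 + C2 + C3); split => //; first by lra.
apply: (@transversal_of_rate _ _ _ Num.sqrt _ _ (ball t0 r)) => //.
- by move=> x y _ xy; exact: ler_wsqrtr.
- by move=> j; elim: j => [|j IH]; rewrite ?expr0 ?sqrtr1// !exprS sqrtrM ?IH// invr_ge0.
- by lra.
- exact: measurable_ball.
- apply: le_trans (mu_ball _ r0 r1) _; rewrite lee_fin.
  have : 2 <= C1.
    rewrite ler_pdivlMr ?sqrtr_gt0// ler_piMr//.
    by rewrite -[leRHS]sqrtr1 ler_wsqrtr// ge_min lexx.
  by lra.
- move=> e d e0 d0.
  have ne : 0 < `|e| by rewrite normr_gt0.
  set x := d / `|e|; have x0 : 0 < x by rewrite divr_gt0.
  have sx0 : 0 < Num.sqrt x by rewrite sqrtr_gt0.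
  have sx2 : Num.sqrt x * Num.sqrt x = x by rewrite -expr2 sqr_sqrtr// ltW.
  have dE : d = x * `|e| by rewrite /x divfK// gt_eqF.
  have [kx|xk] := leP ka x.
    exists (ball t0 r); split => //; first exact: measurable_ball.
    apply: le_trans (mu_ball _ r0 r1) _; rewrite lee_fin.
    have : 2 <= C1 * Num.sqrt x.
      rewrite /C1 -mulrA -ler_pdivrMl// mulVf// mulrC ler_pdivlMr ?sqrtr_gt0//.
      by rewrite mul1r ler_wsqrtr.
    by have := mulr_gt0 C20 sx0; have := mulr_gt0 C30 sx0; nra.
  move: (xk); rewrite lt_min => /andP[x1 xc].
  have xsx : x <= Num.sqrt x.
    by rewrite -{1}sx2 ler_piMr ?ltW// -sqrtr1 ltr_sqrt.
  pose m := c * `|e| / 2; have m0 : 0 < m by rewrite divr_gt0// mulr_gt0.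
  have dG k t : (k < 3)%N -> ball t0 r t -> `|dot (G k t) e - dot (G k t0) e| <= m.
    move=> k3 tb; rewrite -dotBl; apply: le_trans (dot_le_norm _ _) _.
    have := rG k t k3 tb; rewrite /m => h.
    have : `|G k t - G k t0| * `|e| <= c / 6 * `|e| by rewrite ler_wpM2r.
    lra.
  have is_d k t : (k < 2)%N -> ball t0 r t ->
      is_derive t 1 (fun s => dot (G k s) e) (dot (G k.+1 t) e).
    by move=> k3 tb; apply: G_derive => //; exact: rU.
  have [k k3 ck] := cP e.
  have lowk t : ball t0 r t -> m <= `|dot (G k t) e|.
    move=> tb; have := dG k t k3 tb; rewrite /m.
    have := ler_distD (dot (G k t) e) (dot (G k t0) e) 0.
    by rewrite !subr0 [`|_ - dot (G k t) e|]distrC; lra.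
  have [k0|kn0] := eqVneq k 0%N.
    exists set0; split => //; last first.
      by rewrite measure0 lee_fin mulr_ge0 ?ltW//; lra.
    move=> t tb td; have := lowk t tb; rewrite k0 => /le_trans/(_ td).
    rewrite /m dE leNgt => /negP; apply.
    by rewrite mulrC [_ * `|e|]mulrC -mulrA ltr_pM2l.
  have [k1|kn1] := eqVneq k 1%N.
    rewrite k1 in lowk.
    have [S [mS SP Sm]] := sublevel_derive1 (@ball_itv t0 r)
      (fun t tb => is_d 0%N t isT tb) m0 (ltW d0) lowk.
    exists S; split => //; apply: le_trans Sm _; rewrite lee_fin.
    have -> : 4 * (d / m) = C2 * x.
      by rewrite /m /C2 dE; field; rewrite !gt_eqF.
    have : C2 * x <= C2 * Num.sqrt x by rewrite ler_pM2l.
    by have := mulr_gt0 C10 sx0; have := mulr_gt0 C30 sx0; lra.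
  have k2 : k = 2%N by case: (k) k3 kn0 kn1 => [|[|[|]]].
  rewrite k2 in lowk ck.
  (* Balances the two terms of [sublevel_derive2]: [h / m] and [d / h] both equal [sqrt x / c'],
     whence [C3 = (4 + 8) / c']. *)
  pose h := m * Num.sqrt x / c'.
  have h0 : 0 < h by rewrite divr_gt0// mulr_gt0.
  have hE : 4 * (h / m) + 8 * (d / h) = C3 * Num.sqrt x.
    have -> : h / m = Num.sqrt x / c' by rewrite /h; field; rewrite !gt_eqF.
    have -> : d / h = Num.sqrt x / c'.
      rewrite /h dE -{1}sx2 (_ : m = c' ^+ 2 * `|e|).
        by field; rewrite !gt_eqF.
      by rewrite c'2 /m mulrAC.
    by rewrite /C3; lra.
  have C3le : (C3 * Num.sqrt x <= (C1 + C2 + C3) * Num.sqrt x).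
    by rewrite ler_pM2r//; lra.
  have [p|p] := leP 0 (dot (G 2 t0) e).
    have [S [mS SP Sm]] : exists S : set R, [/\ measurable S,
        forall t, ball t0 r t -> `|dot (G 0 t) e| <= d -> S t &
        (mu S <= (4 * (h / m) + 8 * (d / h))%:E)%E].
      apply: (sublevel_derive2 (@ball_itv t0 r) (fun t tb => is_d 0%N t isT tb)
        (fun t tb => is_d 1%N t isT tb) m0 (ltW d0) h0) => t tb.
      have := dG 2%N t isT tb; move: ck; rewrite (ger0_norm p) /m => ck.
      by rewrite ler_norml => /andP[]; lra.
    exists S; split => //; apply: le_trans Sm _.
    by rewrite hE lee_fin.
  have is_dN k' t : (k' < 2)%N -> ball t0 r t ->
      is_derive t 1 (fun s => dot (G k' s) (- e)) (dot (G k'.+1 t) (- e)).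
    by move=> k'3 tb; apply: G_derive => //; exact: rU.
  have dotN u : dot u (- e) = - dot u e by rewrite -scaleN1r dotZr mulN1r.
  have [S [mS SP Sm]] : exists S : set R, [/\ measurable S,
      forall t, ball t0 r t -> `|dot (G 0 t) (- e)| <= d -> S t &
      (mu S <= (4 * (h / m) + 8 * (d / h))%:E)%E].
    apply: (sublevel_derive2 (@ball_itv t0 r) (fun t tb => is_dN 0%N t isT tb)
      (fun t tb => is_dN 1%N t isT tb) m0 (ltW d0) h0) => t tb.
    have := dG 2%N t isT tb; move: ck; rewrite dotN (ltr0_norm p) /m => ck.
    by rewrite ler_norml => /andP[]; lra.
  exists S; split => //; last by apply: le_trans Sm _; rewrite hE lee_fin.
  by move=> t tb td; apply: SP => //; rewrite dotN normrN.
Qed.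

(** Among unit vectors the product with [G 0 t0] is largest at [G 0 t0] itself. This needs only
    derivatives of products with a fixed vector, the form in which [G_derive] is given. *)
Lemma derive_perp t0 : U t0 -> dot (G 1 t0) (G 0 t0) = 0.
Proof.
move=> Ut0; have [r [r0 r1 rU _]] := curve_nearby Ut0 ltr01.
have unit t : U t -> dot (G 0 t) (G 0 t) = 1.
  by move=> Ut; rewrite -[LHS]sqr_sqrtr ?dot_ge0// -/(enorm _) G_unit ?expr1n.
have is_d t : ball t0 r t ->
    is_derive t 1 (fun s => dot (G 0 s) (G 0 t0)) (dot (G 1 t) (G 0 t0)).
  by move=> tb; apply: G_derive => //; exact: rU.
have itvb t : t \in `]t0 - r, t0 + r[%R -> ball t0 r t.
  by rewrite in_itv/= => tI; rewrite -ball_normE/= ltr_distlC.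
have max : is_derive t0 1 (fun s => dot (G 0 s) (G 0 t0)) 0.
  apply: (@derive1_at_max _ _ (t0 - r) (t0 + r)).
  - by lra.
  - by move=> t /itvb /is_d [].
  - by rewrite in_itv/=; apply/andP; split; lra.
  - move=> t /itvb /rU Ut.
    have := dot_ge0 (G 0 t - G 0 t0).
    by rewrite dotBl !dotBr !unit// [dot (G 0 t0) _]dotC; lra.
have [_ <-] := is_d t0 (ballxx t0 r0).
by have [_ ->] := max.
Qed.

Lemma derive_neq0 t0 : U t0 -> G 1 t0 != 0.
Proof.
move=> Ut0; apply: (@free_not0 _ _ _ [:: G 0 t0; G 1 t0; G 2 t0]).
  by rewrite /free G_span// dimvf.
by rewrite !inE eqxx orbT.
Qed.

(* If |e - a (gamma t)| <= d then H t = G 0 t . z is O(d) for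
   z = (e . w) G 0 t0 - (e . G 0 t0) w with w = G 1 t0, because z is
   orthogonal to G 0 t when e is parallel to G 0 t; and
   H' t0 = - (e . G 0 t0) |w|^2. *)
Lemma plane_transversal t0 : U t0 -> exists (r C : R),
  [/\ 0 < r, 0 <= C, ball t0 r `<=` U &
    transversal (ball t0 r) (fun t u => `|proj_plane (G 0) t u|) 2^-1 C].
Proof.
move=> Ut0.
pose w := G 1 t0; pose W := `|w|; pose W2 := dot w w.
have w0 : w != 0 by exact: derive_neq0.
have W0 : 0 < W by rewrite normr_gt0.
have W20 : 0 < W2 by apply: lt_le_trans (sqr_norm_le_dot w); rewrite exprn_gt0.
have wg : dot w (G 0 t0) = 0 by exact: derive_perp.
have g01 : `|G 0 t0| <= 1 by exact: G0_le1.
(* With [1/24] the product of [e] with the curve moves by at most [|e| / 8], and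
   [1/2 + 1/8 + 1/4 < 1]. With [W2 / (72 * W)] and [|z| <= 6 * W * |e|] the derivative of [H] moves
   by at most [W2 * |e| / 4], half of its size at [t0]. *)
pose h := Num.min 24^-1 (W2 / (72 * W)).
have h0 : 0 < h.
  by rewrite lt_min invr_gt0 ltr0n andTb divr_gt0 ?mulr_gt0.
have h24 : h <= 24^-1 by rewrite ge_min lexx.
have hW : h * (72 * W) <= W2.
  by rewrite -ler_pdivlMr ?mulr_gt0// ge_min lexx orbT.
have [r [r0 r1 rU rG]] := curve_nearby Ut0 h0.
pose C1 := 4 * 72 * W / W2; have C10 : 0 < C1 by rewrite divr_gt0// mulr_gt0.
exists r, (8 + C1); split => //; first by lra.
apply: (@transversal_of_rate _ _ _ id _ _ (ball t0 r)) => //.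
- by lra.
- exact: measurable_ball.
- by apply: le_trans (mu_ball _ r0 r1) _; rewrite lee_fin; lra.
move=> e d e0 d0.
have ne : 0 < `|e| by rewrite normr_gt0.
set x := d / `|e|; have x0 : 0 < x by rewrite divr_gt0.
have dE : d = x * `|e| by rewrite /x divfK// gt_eqF.
have [kx|xk] := leP 4^-1 x.
  exists (ball t0 r); split => //; first exact: measurable_ball.
  apply: le_trans (mu_ball _ r0 r1) _; rewrite lee_fin.
  by have := mulr_gt0 C10 x0; lra.
have near k t : (k < 3)%N -> ball t0 r t -> forall z,
    `|dot (G k t) z - dot (G k t0) z| <= 3 * (h * `|z|).
  move=> k3 tb z; rewrite -dotBl; apply: le_trans (dot_le_norm _ _) _.
  by rewrite ler_wpM2l// ler_wpM2r//; exact: rG.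
have g1 t : ball t0 r t -> `|G 0 t| <= 1 by move=> /rU/G0_le1.
have dot1 (u v : 'rV[R]_3) : `|u| <= 1 -> `|dot u v| <= 3 * `|v|.
  move=> u1; apply: le_trans (dot_le_norm _ _) _; rewrite ler_wpM2l//.
  by rewrite ler_piMl.
(* If [e] has a small component along the curve, its projection is larger than [|e| / 4 > d] on the
   whole ball. *)
have [ge|ge] := leP (`|e| / 2) `|dot (G 0 t0) e|; last first.
  exists set0; split => //; last first.
    by rewrite measure0 lee_fin mulr_ge0 ?ltW//; lra.
  move=> t tb; apply/negP; rewrite -ltNge dE.
  set a := dot (G 0 t0) e in ge; set b := dot (G 0 t) e.
  have ab : `|b - a| <= 3 * (h * `|e|) by exact: near.
  have e_le : `|e| <= `|proj_plane (G 0) t e| + (`|b - a| + `|a|).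
    rewrite -{1}(subrK (b *: G 0 t) e).
    apply: le_trans (ler_normD _ _) _; rewrite lerD2l normrZ.
    apply: le_trans (_ : `|b| * 1 <= _); first by rewrite ler_wpM2l// g1.
    by rewrite mulr1 -{1}(subrK a b); exact: ler_normD.
  have he : h * `|e| <= 24^-1 * `|e| by rewrite ler_wpM2r.
  have xe : x * `|e| < 4^-1 * `|e| by rewrite ltr_pM2r.
  by lra.
pose z := dot e w *: G 0 t0 - dot e (G 0 t0) *: w.
pose m := W2 * `|e| / 4; have m0 : 0 < m by rewrite divr_gt0// mulr_gt0.
have ew : `|dot e w| <= 3 * (`|e| * W) by exact: dot_le_norm.
have eg : `|dot e (G 0 t0)| <= 3 * `|e| by rewrite dotC; exact: dot1.
have zle : `|z| <= 6 * (W * `|e|).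
  apply: le_trans (ler_normB _ _) _; rewrite !normrZ -/W.
  have : `|dot e w| * `|G 0 t0| <= 3 * (`|e| * W) * 1 by exact: ler_pM.
  have : `|dot e (G 0 t0)| * W <= 3 * `|e| * W by rewrite ler_wpM2r// ltW.
  by lra.
have is_d t : ball t0 r t ->
    is_derive t 1 (fun s => dot (G 0 s) z) (dot (G 1 t) z).
  by move=> tb; apply: G_derive => //; exact: rU.
have dz0 : dot (G 1 t0) z = - (dot e (G 0 t0) * W2).
  by rewrite /z dotBr !dotZr wg mulr0 sub0r.
have lowd t : ball t0 r t -> m <= `|dot (G 1 t) z|.
  move=> tb; have := near 1%N t isT tb z; rewrite dz0.
  set H := dot (G 1 t) z => Hz.
  have hz : 3 * (h * `|z|) <= W2 * `|e| / 4.
    have : h * `|z| <= h * (6 * (W * `|e|)) by rewrite ler_pM2l.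
    have : h * (72 * W) * `|e| <= W2 * `|e| by rewrite ler_wpM2r.
    by lra.
  have : `|e| / 2 * W2 <= `|- (dot e (G 0 t0) * W2)|.
    by rewrite normrN normrM (gtr0_norm W20) ler_pM2r// dotC.
  have := ler_distD H (- (dot e (G 0 t0) * W2)) 0.
  by rewrite !subr0 distrC /m; lra.
(* Each of the two products in the expansion of [H t] is at most [9 * d * W]. *)
have d180 : 0 <= 18 * (d * W) by rewrite !mulr_ge0// ltW.
have [S [mS SP Sm]] := sublevel_derive1 (@ball_itv t0 r) is_d m0 d180 lowd.
exists S; split => //; last first.
  apply: le_trans Sm _; rewrite lee_fin.
  have -> : 4 * (18 * (d * W) / m) = C1 * x.
    by rewrite /m /C1 dE; field; rewrite !gt_eqF.
  by rewrite ler_pM2r//; lra.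
move=> t tb td; apply: SP => //.
set p := proj_plane (G 0) t e in td; set a := dot (G 0 t) e.
have eE : e = a *: G 0 t + p by rewrite /p /proj_plane addrC subrK.
have -> : dot (G 0 t) z = dot p w * dot (G 0 t) (G 0 t0) -
    dot p (G 0 t0) * dot (G 0 t) w.
  by rewrite /z dotBr !dotZr {1 2}eE !dotDl !dotZl; ring.
apply: le_trans (ler_normB _ _) _; rewrite !normrM.
have p1 : `|dot p w| <= 3 * (d * W).
  by apply: le_trans (dot_le_norm _ _) _; rewrite ler_wpM2l// ler_wpM2r.
have p2 : `|dot p (G 0 t0)| <= 3 * d.
  by rewrite dotC; apply: le_trans (dot1 _ _ g01) _; rewrite ler_wpM2l.
have p3 : `|dot (G 0 t) (G 0 t0)| <= 3.
  by apply: le_trans (dot1 _ _ (g1 t tb)) _; lra.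
have p4 : `|dot (G 0 t) w| <= 3 * W by exact/dot1/g1.
have : `|dot p w| * `|dot (G 0 t) (G 0 t0)| <= 3 * (d * W) * 3 by exact: ler_pM.
have : `|dot p (G 0 t0)| * `|dot (G 0 t) w| <= 3 * d * (3 * W) by exact: ler_pM.
by lra.
Qed.

End CurveTransversality.

(** * Dimensions of images *)

Section HausdorffImages.
Context {R : realType}.
Local Open Scope ereal_scope.

Lemma hausdorff_dim_ge0 (X : Type) (d : X -> X -> R) (A : set X) :
  0 <= hausdorff_dim d A.
Proof. by apply/ereal_infP => _ [s [s0 _] <-]; rewrite lee_fin. Qed.

Lemma diameter_fin (X : Type) (d : X -> X -> R) (A : set X) (c : R) :
  diameter d A <= c%:E -> diameter d A = (fine (diameter d A))%:E.
Proof.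
move=> Ac; rewrite fineK// ge0_fin_numE ?diameter_ge0//.
by rewrite (le_lt_trans Ac)// ltry.
Qed.

Lemma hausdorff_dim_lipschitz (X Y : Type) (d : X -> X -> R) (d' : Y -> Y -> R)
    (f : X -> Y) (L : R) (A : set X) : (0 < L)%R ->
  (forall x y, d' (f x) (f y) <= L * d x y)%R ->
  hausdorff_dim d' (f @` A) <= hausdorff_dim d A.
Proof.
move=> L0 fL; apply/ereal_infP => _ [s [s0 As] <-].
apply: ereal_inf_lbound; exists s => //; split=> //.
apply: hausdorff_measure_eq0 => c e c0 e0.
have Ls0 : (0 < L `^ s)%R by rewrite powR_gt0.
have cL0 : (0 < c / L)%R by rewrite divr_gt0.
have : hausdorff_content d s (c / L) A < (e / L `^ s)%:E.
  by rewrite (hausdorff_content_eq0 cL0 As) lte_fin divr_gt0.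
move=> /ereal_inf_lt[_ [E [AE Ec] <-] Ee].
apply: (@le_trans _ _ (\sum_(0 <= i <oo) diameter_pow d' s (f @` E i))).
  apply: ereal_inf_lbound; exists (fun i => f @` E i) => //; split.
    by move=> _ [x /AE[i _ Ex] <-]; exists i => //; exists x.
  move=> i; apply: diameter_le; first exact: ltW.
  move=> _ _ [x Ex <-] [y Ey <-]; apply: le_trans (fL x y) _.
  by rewrite mulrC -ler_pdivlMr//; exact: (dist_le_diameter (Ec i)).
apply: (@le_trans _ _ (\sum_(0 <= i <oo) (L `^ s)%:E * diameter_pow d s (E i))).
  apply: lee_nneseries; first by move=> i _ _; exact: diameter_pow_ge0.
  move=> i _.
  have [E0|E0] := eqVneq (E i) set0.
    by rewrite E0 image_set0 /diameter_pow !eqxx mule0.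
  have dE := diameter_fin (Ec i); set dl := fine _ in dE.
  have dl0 : (0 <= dl)%R by rewrite fine_ge0// diameter_ge0.
  rewrite {2}/diameter_pow (negPf E0) dE poweR_EFin -EFinM -powRM ?(ltW L0)//.
  apply: diameter_pow_le => //; first by rewrite mulr_ge0// ltW.
  move=> _ _ [x Ex <-] [y Ey <-]; apply: le_trans (fL x y) _.
  by rewrite ler_pM2l//; apply: (dist_le_diameter _ Ex Ey); rewrite dE.
rewrite nneseriesZl; last by move=> i _; exact: diameter_pow_ge0.
apply: le_trans (lee_wpmul2l _ (ltW Ee)) _; first by rewrite lee_fin ltW.
by rewrite -EFinM lee_fin mulrC divfK// gt_eqF.
Qed.

Lemma expr_lt_pos (b e : R) : (0 <= b)%R -> (b < 1)%R -> (0 < e)%R ->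
  exists k, (b ^+ k <= e)%R.
Proof.
move=> b0 b1 e0.
have : (fun n => b ^+ n)%R @ \oo --> (0 : R)%R.
  by apply: cvg_expr; rewrite ger0_norm.
move=> /cvgr0Pnorm_le/(_ e e0)[k _ kP]; exists k.
by have := kP k (leqnn k); rewrite ger0_norm// exprn_ge0.
Qed.

(** For [dl > 0], [k] satisfies [2^-(k+2) < dl <= 2^-(k+1)], so [2^-k] is below [4 * dl]; the term
    [e] is for [dl = 0], where no scale is comparable. The exponent [k + 1] leaves room for
    enlarging the covering sets. *)
Lemma dyadic_scale (dl s sg e : R) : (0 <= dl)%R -> (dl <= 4^-1)%R ->
  (0 <= s)%R -> (s <= sg)%R -> (0 < sg)%R -> (0 < e)%R ->
  exists k, (dl <= 2^-1 ^+ k.+1)%R /\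
    ((2^-1 `^ sg) ^+ k <= 4 `^ sg * dl `^ s + e)%R.
Proof.
move=> dl0 dl4 s0 ssg sg0 e0.
have b0 : (0 <= 2^-1 `^ sg :> R)%R by exact: powR_ge0.
have b1 : (2^-1 `^ sg < 1 :> R)%R.
  apply: (@lt_le_trans _ _ (1 `^ sg)%R); last by rewrite powR1.
  apply: gt0_ltr_powR => //.
  - by rewrite nnegrE invr_ge0.
  - by rewrite nnegrE.
  - by rewrite invf_lt1// ltr1n.
have [->|dn0] := eqVneq dl 0%R.
  have [k ke] := expr_lt_pos b0 b1 e0; exists k; split.
    by rewrite exprn_ge0// invr_ge0.
  by apply: ler_wpDl => //; rewrite mulr_ge0// powR_ge0.
have dp : (0 < dl)%R by rewrite lt_neqAle eq_sym dn0.
have ex : exists k, (2^-1 ^+ k.+2 < dl)%R.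
  have h0 : (0 <= 2^-1 :> R)%R by rewrite invr_ge0.
  have h1 : (2^-1 < 1 :> R)%R by rewrite invf_lt1// ltr1n.
  have [k kd] := expr_lt_pos h0 h1 dp; exists k.
  apply: lt_le_trans kd; rewrite 2!exprS.
  have : (0 < 2^-1 ^+ k :> R)%R by rewrite exprn_gt0// invr_gt0.
  by lra.
case: (ex_minnP ex) => k kd kmin; exists k; split.
  case: k kd kmin => [|k] kd kmin.
    by apply: le_trans dl4 _; rewrite expr1 lef_pV2 ?posrE// ler_nat.
  by rewrite leNgt; apply/negP => /kmin; rewrite ltnn.
apply: ler_wpDr; first exact: ltW.
have -> : ((2^-1 `^ sg) ^+ k = (2^-1 ^+ k) `^ sg :> R)%R.
  have h0 : (0 <= 2^-1 :> R)%R by rewrite invr_ge0.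
  by rewrite -(powR_mulrn k b0) -(powR_mulrn k h0) powRAC.
apply: (@le_trans _ _ ((4 * dl) `^ sg)%R).
  apply: ge0_ler_powR; first exact: ltW.
  - by rewrite nnegrE exprn_ge0// invr_ge0.
  - by rewrite nnegrE mulr_ge0.
  - by move: kd; rewrite 2!exprS; lra.
rewrite powRM// ler_wpM2l ?powR_ge0//.
by apply: ger_powR => //; rewrite dp; lra.
Qed.

Lemma hausdorff_dim_lt_thin (n : nat) (Y : Type) (d : Y -> Y -> R)
    (P : 'rV[R]_n -> Y) (N : 'rV[R]_n -> R) (L sg : R) (A : set 'rV[R]_n) :
  (0 < L)%R -> (0 < sg)%R ->
  (forall u v, N (u + v) <= N u + N v)%R -> (forall u, N u <= L * `|u|)%R ->
  (forall x y, N (x - y) <= d (P x) (P y))%R ->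
  hausdorff_dim d (P @` A) < sg%:E -> thin (2^-1 `^ sg) N A.
Proof.
move=> L0 sg0 ND NL Nd /ereal_inf_lt[_ [s [s0 As] <-]]; rewrite lte_fin => ssg e e0.
pose b : R := (2^-1 `^ sg)%R.
have q0 : (0 < 4^-1 :> R)%R by rewrite invr_gt0.
have F0 : (0 < 4 `^ sg :> R)%R by rewrite powR_gt0.
pose e' : R := (Num.min 2^-1 (e / 2 / 4 `^ sg))%R.
have e'0 : (0 < e')%R by rewrite lt_min invr_gt0 ltr0n andTb !divr_gt0.
have : hausdorff_content d s 4^-1 (P @` A) < e'%:E.
  by rewrite (hausdorff_content_eq0 q0 As) lte_fin.
move=> /ereal_inf_lt[_ [E [AE Ec] <-] Ee].
pose pw i := fine (diameter_pow d s (E i)).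
have pwE i : diameter_pow d s (E i) = (pw i)%:E.
  rewrite /pw fineK// ge0_fin_numE ?diameter_pow_ge0//.
  rewrite /diameter_pow; case: ifP => _; first exact: ltry.
  by rewrite (diameter_fin (Ec i)) poweR_EFin ltry.
have ei0 i : (0 < e / 2 / 2 ^+ i.+1)%R by rewrite !divr_gt0// exprn_gt0.
have /choice[k kP] i : exists k,
    (forall x y, E i x -> E i y -> d x y <= 2^-1 ^+ k.+1)%R /\
    (b ^+ k <= 4 `^ sg * pw i + e / 2 / 2 ^+ i.+1)%R.
  have dE := diameter_fin (Ec i); set dl := fine _ in dE.
  have dl0 : (0 <= dl)%R by rewrite fine_ge0// diameter_ge0.
  have dl4 : (dl <= 4^-1)%R by rewrite -lee_fin -dE.
  have [E0|E0] := eqVneq (E i) set0.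
    (* The exponent [sg] replaces [s] here: the empty set contributes 0, whereas [0 ^ s] would be 1
       for [s = 0]. *)
    have [k [_ kb]] := dyadic_scale (lexx 0%R) (ltW q0) (ltW sg0) (lexx sg) sg0 (ei0 i).
    exists k; split=> [x y|]; first by rewrite E0.
    rewrite /pw /diameter_pow E0 eqxx mulr0 add0r.
    by move: kb; rewrite powR0 ?gt_eqF// mulr0 add0r.
  have [k [kd kb]] := dyadic_scale dl0 dl4 s0 (ltW ssg) sg0 (ei0 i).
  exists k; split=> [x y Ex Ey|].
    by apply: le_trans kd; apply: (dist_le_diameter _ Ex Ey); rewrite dE.
  by rewrite /pw /diameter_pow (negPf E0) dE poweR_EFin.
(* Two enlargements cost [2 * L * eta = 2^-k / 2], which together with [2^-(k+1)] is exactly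
   [2^-k]. *)
pose eta i := (2^-1 ^+ (k i) / (4 * L))%R.
have eta0 i : (0 < eta i)%R.
  by rewrite divr_gt0 ?mulr_gt0// exprn_gt0// invr_gt0.
exists (fun i => \bigcup_(a in [set a | E i (P a)]) ball a (eta i)), k; split.
- by move=> i; apply: bigcup_open => a _; exact: ball_open.
- move=> x Ax; have [|i _ Ex] := AE (P x); first by exists x.
  by exists i => //; exists x => //; exact: ballxx.
- move=> i x y [a /= Ea xa] [a' /= Ea' ya'].
  have -> : (x - y = (x - a) + ((a - a') + (a' - y)))%R.
    by rewrite !addrA subrK subrK.
  apply: le_trans (ND _ _) _.
  have h1 : (N (x - a) <= L * eta i)%R.
    apply: le_trans (NL _) _; rewrite ler_pM2l// distrC.
    by move: xa; rewrite -ball_normE/= => /ltW.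
  have h2 : (N (a' - y) <= L * eta i)%R.
    apply: le_trans (NL _) _; rewrite ler_pM2l//.
    by move: ya'; rewrite -ball_normE/= => /ltW.
  have h3 : (N (a - a') <= 2^-1 ^+ (k i).+1)%R.
    by apply: le_trans (Nd _ _) _; have [+ _] := kP i; exact.
  have h4 : (L * eta i = 2^-1 ^+ (k i) / 4)%R.
    by rewrite /eta; field; rewrite gt_eqF.
  have := ND (a - a')%R (a' - y)%R.
  by move: h3; rewrite exprS; lra.
- move=> M.
  apply: (@le_trans _ _ (\sum_(i < M) (4 `^ sg * pw i + e / 2 / 2 ^+ i.+1))%R).
    by apply: ler_sum => i _; have [_] := kP i.
  rewrite big_split/= -mulr_sumr.
  have h1 : (\sum_(i < M) pw i <= e')%R.
    rewrite -lee_fin -sumEFin; apply: le_trans (ltW Ee).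
    have := @nneseries_lim_ge _ (fun i => diameter_pow d s (E i)) xpredT 0 M.
    rewrite big_mkord; under eq_bigr do rewrite pwE.
    by apply=> i _ _; exact: diameter_pow_ge0.
  have h2 : (\sum_(i < M) e / 2 / 2 ^+ i.+1 <= e / 2)%R.
    have -> : (\sum_(i < M) e / 2 / 2 ^+ i.+1 = e / 4 * \sum_(i < M) 2^-1 ^+ i)%R.
      rewrite mulr_sumr; apply: eq_bigr => i _; rewrite exprVn exprS; field.
      by rewrite expf_eq0 pnatr_eq0 andbF.
    have : (\sum_(i < M) 2^-1 ^+ i <= (1 - 2^-1)^-1 :> R)%R.
      by apply: sum_expr_le; rewrite ?invr_ge0// invf_lt1// ltr1n.
    have -> : ((1 - 2^-1)^-1 = 2 :> R)%R by field.
    by nra.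
  have h3 : (4 `^ sg * e' <= e / 2)%R.
    by rewrite mulrC -ler_pdivlMr// ge_min lexx orbT.
  have : (4 `^ sg * \sum_(i < M) pw i <= 4 `^ sg * e')%R by rewrite ler_pM2l.
  by lra.
Qed.

End HausdorffImages.

(** * Dimension of almost every projection *)

Section Localization.
Context {R : realType}.
Local Notation mu := (@lebesgue_measure R).

(** Lindelöf: countably many balls with rational centres and radii [1 / (m + 1)] suffice, and on
    each good one the exceptional set is null. *)
Lemma ae_local (U : set R) (Q : R -> Prop) :
  (forall t0, U t0 -> exists2 r : R, 0 < r & {ae mu, forall t, ball t0 r t -> Q t}) ->
  {ae mu, forall t, U t -> Q t}.
Proof.
move=> UQ.
pose I (p : rat * nat) : set R := ball (ratr p.1 : R) p.2.+1%:R^-1.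
pose good p := {ae mu, forall t, I p t -> Q t}.
pose F (k : nat) : set R := oapp (fun p => if `[< good p >] then
  [set t | I p t /\ ~ Q t] else set0) set0 (pickle_inv k).
have F0 k : mu.-negligible (F k).
  rewrite /F; case: (pickle_inv k) => [p|]/=; last exact: negligible_set0.
  case: ifPn => [/asboolP gp|_]; last exact: negligible_set0.
  by apply: negligibleS gp => t [It nQ] /= /(_ It).
apply: negligibleS (negligible_bigcup F0) => t /= /not_implyP[Ut nQ].
have [r r0 rQ] := UQ t Ut.
pose m := Num.bound (2 / r).
pose w : R := m.+1%:R^-1.
have m0 : 0 < w by rewrite invr_gt0.
have mr : 2 * w < r.
  rewrite ltr_pdivrMr// mulrC -ltr_pdivrMr//.
  apply: lt_trans (archi_boundP _) _; first by rewrite divr_ge0// ltW.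
  by rewrite ltr_nat.
have [x] : exists x, ratr x \in `]t - w, t + w[%R.
  by apply: rat_in_itvoo; lra.
rewrite in_itv/= => /andP[x1 x2].
have It : I (x, m) t.
  by rewrite /I -ball_normE/= -/w ltr_distlC; apply/andP; split; lra.
exists (pickle (x, m)); first exact: Logic.I.
rewrite /F pickleK_inv/=; case: ifPn => [_|/asboolP ng]; first by split.
exfalso; apply: ng.
apply: (@filterS _ _ (ae_filter_ringOfSetsType _) _ _ _ rQ) => y rQy Iy.
apply: rQy; move: Iy; rewrite /I -!ball_normE/= -/w ltr_distlC => /andP[y1 y2].
by rewrite ltr_distlC; apply/andP; split; lra.
Qed.

Lemma ltr_powR_lt1 (x s s' : R) : 0 < x -> x < 1 -> s < s' -> x `^ s' < x `^ s.
Proof.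
move=> x0 x1 ss; rewrite /powR gt_eqF// ltr_expR ltr_nM2r//.
by apply: ln_lt0; rewrite x0.
Qed.

Lemma analytic_ae_not_thin (n : nat) (B : set 'rV[R]_n) (I : set R)
    (N : R -> 'rV[R]_n -> R) (C a s s' : R) :
  analytic B -> B !=set0 -> 0 < s -> s < s' -> s < a -> 0 <= C ->
  transversal I N (2^-1 `^ a) C ->
  hausdorff_measure Defs.edist s' B <> 0%E ->
  {ae mu, forall t, I t -> ~ thin (2^-1 `^ s) (N t) B}.
Proof.
move=> [->|[f cf ->]]; first by move=> [].
move=> _ s0 ss' sa C0 tr Hs.
have h0 : 0 < 2^-1 :> R by rewrite invr_gt0.
have h1 : 2^-1 < 1 :> R by rewrite invf_lt1// ltr1n.
have b1 : 2^-1 `^ s < 1 :> R by have := ltr_powR_lt1 h0 h1 s0; rewrite powRr0.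
have [c c0 cap] : exists2 c : R, 0 < c &
    (c%:E < capacity (level_kernel floor_key (2^-1 `^ s)) (range f))%E.
  apply: contrapT => nc; apply: Hs.
  apply: (@hausdorff_measure0_capacity R _ _ Defs.edist floor_key
    (2^-1 `^ s) s' n.+1%:R) => //.
  - exact: lt_trans ss'.
  - exact: ltr_powR_lt1.
  - move=> j x y /floor_key_close xy; apply: le_trans (enorm_le_norm _) _.
    by apply: ler_pM => //; rewrite ler_nat.
  - by move=> c c0 cc; apply: nc; exists c.
apply: (ae_not_thin cf _ _ b1 C0 tr c0 cap); first by rewrite powR_gt0.
exact: ltr_powR_lt1.
Qed.

Lemma ae_dim_projection (n : nat) (Y : Type) (d : Y -> Y -> R)
    (P : R -> 'rV[R]_n -> Y) (N : R -> 'rV[R]_n -> R) (U : set R) (a L : R)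
    (B : set 'rV[R]_n) :
  analytic B -> 0 < L ->
  (forall t0, U t0 -> exists r C : R, [/\ 0 < r, 0 <= C, ball t0 r `<=` U &
    transversal (ball t0 r) N (2^-1 `^ a) C]) ->
  (forall t u v, U t -> N t (u + v) <= N t u + N t v) ->
  (forall t u, U t -> N t u <= L * `|u|) ->
  (forall t x y, U t -> N t (x - y) <= d (P t x) (P t y)) ->
  (forall t x y, U t -> d (P t x) (P t y) <= L * Defs.edist x y) ->
  (dimH B <= a%:E)%E ->
  {ae mu, forall t, U t -> hausdorff_dim d (P t @` B) = dimH B}.
Proof.
move=> aB L0 tr ND NL Nd dL Ba.
have upper t : U t -> (hausdorff_dim d (P t @` B) <= dimH B)%E.
  by move=> Ut; apply: (@hausdorff_dim_lipschitz _ _ _ _ _ _ L) => // x y; exact: dL.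
have Bfin : dimH B \is a fin_num.
  by rewrite ge0_fin_numE ?hausdorff_dim_ge0// (le_lt_trans Ba)// ltry.
pose D := fine (dimH B); have DE : dimH B = D%:E by rewrite fineK.
have D0 : 0 <= D by rewrite -lee_fin -DE hausdorff_dim_ge0.
have Da : D <= a by rewrite -lee_fin -DE.
have [Dz|Dn0] := eqVneq D 0.
  apply: (@filterS _ _ (ae_filter_ringOfSetsType _) setT); last exact: filterT.
  move=> t _ Ut; apply/eqP; rewrite eq_le upper//= DE Dz.
  exact: hausdorff_dim_ge0.
have Dpos : 0 < D by rewrite lt_neqAle eq_sym Dn0.
have B0 : B !=set0.
  apply/set0P/eqP => B0; have : (dimH B <= 0%:E)%E.
    apply: ereal_inf_lbound; exists 0 => //; split=> //.
    apply: hausdorff_measure_eq0 => c e c0 e0; rewrite B0.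
    apply: (@le_trans _ _
      (\sum_(0 <= i <oo) diameter_pow Defs.edist 0 (@set0 'rV[R]_n)))%E.
      apply: ereal_inf_lbound; exists (fun=> set0) => //; split=> // i.
      by apply: diameter_le => //; exact: ltW.
    by rewrite eseries0 ?lee_fin ?ltW// => i _ _; rewrite /diameter_pow eqxx.
  by rewrite DE lee_fin leNgt Dpos.
(* Exponents that increase to [D]; [j.+2] keeps the first one positive. *)
pose sg (j : nat) := D * (1 - j.+2%:R^-1).
have sgP j : 0 < sg j < D.
  have j1 : 0 < j.+2%:R^-1 :> R by rewrite invr_gt0.
  have j2 : j.+2%:R^-1 < 1 :> R by rewrite invf_lt1// ltr1n.
  by rewrite /sg mulr_gt0 ?subr_gt0//= gtr_pMr// gtrBl.
have step j : {ae mu, forall t, U t -> ((sg j)%:E <= hausdorff_dim d (P t @` B))%E}.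
  have /andP[s0 sD] := sgP j.
  apply: ae_local => t0 Ut0; have [r [C [r0 C0 rU trC]]] := tr t0 Ut0.
  (* [s' < D] makes the measure at exponent [s'] nonzero, and [sg j < s'] pays for the passage to
     capacity. *)
  exists r => //; pose s' := (sg j + D) / 2.
  have Hs : hausdorff_measure Defs.edist s' B <> 0%E.
    move=> Bs'; have : (dimH B <= s'%:E)%E.
      by apply: ereal_inf_lbound; exists s' => //; split=> //; rewrite /s'; lra.
    by rewrite DE lee_fin /s'; lra.
  have ss' : sg j < s' by rewrite /s'; lra.
  have nthin := analytic_ae_not_thin aB B0 s0 ss' (lt_le_trans sD Da) C0 trC Hs.
  apply: (@filterS _ _ (ae_filter_ringOfSetsType _) _ _ _ nthin) => t tP tb.
  rewrite leNgt; apply/negP => lt; apply: (tP tb).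
  have Ut := rU t tb.
  apply: (@hausdorff_dim_lt_thin _ _ _ d (P t) (N t) L (sg j)) => //.
  - by move=> u v; exact: ND.
  - by move=> u; exact: NL.
  - by move=> x y; exact: Nd.
have all_step := ae_foralln step.
apply: (@filterS _ _ (ae_filter_ringOfSetsType _) _ _ _ all_step) => t tP Ut.
apply/eqP; rewrite eq_le upper//= DE.
have dfin : hausdorff_dim d (P t @` B) \is a fin_num.
  by rewrite ge0_fin_numE ?hausdorff_dim_ge0// (le_lt_trans (upper t Ut))// DE ltry.
rewrite -(fineK dfin) lee_fin leNgt; apply/negP => lt.
set h := fine _ in lt.
pose j := Num.bound (D / (D - h)).
have Dh : 0 < D - h by rewrite subr_gt0.
have := tP j Ut; rewrite -(fineK dfin) -/h lee_fin leNgt => /negP; apply.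
rewrite /sg mulrBr mulr1 ltrBrDr -ltrBrDl.
rewrite ltr_pdivrMr// mulrC -ltr_pdivrMr//.
apply: lt_trans (archi_boundP _) _; first by rewrite divr_ge0// ltW.
by rewrite ltr_nat.
Qed.

End Localization.

Section CurveDerivatives.
Context {R : realType} (U : set R) (gamma : R -> 'rV[R]_3).
Hypotheses (oU : open U) (ndg : nondegenerate_curve U gamma).

Lemma curve_continuous k t : (k < 3)%N -> U t ->
  {for t, continuous (derive1n k gamma)}.
Proof.
move=> k3 Ut; have [[dG _] _ _] := ndg.
by apply: differentiable_continuous; apply/derivable1_diffP; exact: dG.
Qed.

Lemma curve_is_derive k t v : (k < 2)%N -> U t ->
  is_derive t 1 (fun s => dot (derive1n k gamma s) v) (dot (derive1n k.+1 gamma t) v).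
Proof.
move=> k2 Ut; have [[dG _] _ _] := ndg.
by rewrite derive1nS; apply: is_derive_dot; apply: dG => //; exact: ltnW.
Qed.

Lemma curve_norm_le1 t : U t -> `|gamma t| <= 1.
Proof. by move=> Ut; have [_ g1 _] := ndg; rewrite -(g1 t Ut) norm_le_enorm. Qed.

Lemma curve_dot_le t u : U t -> `|dot (gamma t) u| <= 3 * `|u|.
Proof.
move=> /curve_norm_le1 g1; apply: le_trans (dot_le_norm _ _) _.
by rewrite ler_wpM2l// ler_piMl.
Qed.

Lemma proj_planeB t x y :
  proj_plane gamma t (x - y) = proj_plane gamma t x - proj_plane gamma t y.
Proof. by apply/rowP => i; rewrite /proj_plane dotBr !mxE; ring. Qed.

Lemma proj_planeD t x y :
  proj_plane gamma t (x + y) = proj_plane gamma t x + proj_plane gamma t y.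
Proof.
apply/rowP => i; rewrite /proj_plane dotC dotDl ![dot _ (gamma t)]dotC !mxE.
by ring.
Qed.

End CurveDerivatives.

Theorem proposition1p5 (R : realType) (U : set R) (gamma : R -> 'rV[R]_3)
    (hU : open_interval U) (hgamma : nondegenerate_curve U gamma)
    (B : set 'rV[R]_3) (hB : analytic B) :
  ((dimH B <= (1 / 2)%:E)%E ->
    {ae lebesgue_measure, forall t, U t ->
      dimH_line (rho gamma t @` B) = dimH B}) /\
  ((dimH B <= 1%:E)%E ->
    {ae lebesgue_measure, forall t, U t ->
      dimH (proj_plane gamma t @` B) = dimH B}).
Proof.
have [oU _] := hU; have [_ unit span] := hgamma.
have h0 : 0 <= 2^-1 :> R by rewrite invr_ge0.
have edist_ge (x y : 'rV[R]_3) : `|x - y| <= Defs.edist x y by exact: norm_le_enorm.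
have dot_le := curve_dot_le hgamma.
split.
- apply: (@ae_dim_projection R 3 R (fun x y => `|x - y|) (rho gamma)
    (fun t u => `|dot (gamma t) u|) U (1 / 2) 3 B hB).
  + by [].
  + move=> t0 Ut0; rewrite div1r powR12_sqrt//.
    exact: (line_transversal oU (curve_continuous hgamma) (curve_is_derive hgamma)
      span Ut0).
  + by move=> t u v _; rewrite dotC dotDl ![dot _ (gamma t)]dotC; exact: ler_normD.
  + by move=> t u; exact: dot_le.
  + by move=> t x y _; rewrite /rho dotBr.
  + move=> t x y Ut; rewrite /rho -dotBr; apply: le_trans (dot_le t _ Ut) _.
    by rewrite ler_pM2l.
- have proj_le t u : U t -> `|proj_plane gamma t u| <= 4 * `|u|.
    move=> Ut; apply: le_trans (ler_normB _ _) _; rewrite normrZ.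
    have := dot_le t u Ut; have := curve_norm_le1 hgamma Ut => g1 du.
    have : `|dot (gamma t) u| * `|gamma t| <= 3 * `|u| * 1 by exact: ler_pM.
    by lra.
  (* The constant 12 is the 4 of [proj_le] times the 3 that compares the Euclidean norm with the sup
     norm. *)
  apply: (@ae_dim_projection R 3 _ Defs.edist (proj_plane gamma)
    (fun t u => `|proj_plane gamma t u|) U 1 12 B hB).
  + by [].
  + move=> t0 Ut0; rewrite powRr1//.
    exact: (plane_transversal oU (curve_continuous hgamma) (curve_is_derive hgamma)
      unit span Ut0).
  + by move=> t u v _; rewrite proj_planeD; exact: ler_normD.
  + move=> t u Ut; apply: le_trans (proj_le t u Ut) _.
    by rewrite ler_wpM2r//; lra.
  + by move=> t x y _; rewrite proj_planeB; exact: edist_ge.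
  + move=> t x y Ut; apply: le_trans (enorm_le_norm _) _.
    rewrite -proj_planeB; have := proj_le t (x - y) Ut; have := edist_ge x y.
    by lra.
Qed.
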